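(* For a weak bimonoid $B$ in a Cauchy complete braided monoidal category $(\mathcal M,\otimes,K,c)$, the following assertions are equivalent. (1) The weak bimonad $\bullet\otimes B$ on $(\mathcal M,\otimes,K)$ is a right weak Hopf monad. (2) The weak bimonad $\bullet\otimes B=B\,\overline\otimes\,\bullet$ on $(\mathcal M,\overline\otimes,K)$ is a left weak Hopf monad. (3) $B$ is a weak Hopf monoid in $(\mathcal M,\otimes,K,c)$. (4) $B$ is a weak Hopf monoid in $(\mathcal M,\overline\otimes,K,\overline c)$.
   Context: Monoidal categories need not be strict, but coherence isomorphisms are suppressed. An object also denotes its identity morphism. Cauchy complete means that idempotent morphisms split. $B^n$ denotes $B^{\otimes n}$. The reversed monoidal product is $X\,\overline\otimes\,Y=Y\otimes X$, with braiding $\overline c_{X,Y}=c_{Y,X}:X\overline\otimes Y=Y\otimes X\to X\otimes Y=Y\overline\otimes X$. A weak bimonoid in a braided monoidal category is an object $B$ with a monoid structure $(\mu,\eta)$ and a comonoid structure $(\delta,\varepsilon)$ such that (b) $\delta\mu=(\mu\otimes\mu)(B\otimes c_{B,B}\otimes B)(\delta\otimes\delta)$; (v) $\varepsilon\mu^2=(\varepsilon\otimes\varepsilon)(\mu\otimes\mu)(B\otimes\delta\otimes B)=(\varepsilon\otimes\varepsilon)(\mu\otimes\mu)(B\otimes c^{-1}_{B,B}\delta\otimes B)$ as morphisms $B^3\to K$, where $\mu^2$ is the iterated multiplication; (w) $(\delta\otimes B)\delta\eta=(B\otimes\mu\otimes B)(\delta\otimes\delta)(\eta\otimes\eta)=(B\otimes\mu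 c^{-1}_{B,B}\otimes B)(\delta\otimes\delta)(\eta\otimes\eta)$ as morphisms $K\to B^3$. The same data $(B,\mu,\eta,\delta,\varepsilon)$ then form a weak bimonoid in $(\mathcal M,\overline\otimes,K,\overline c)$. Put $t=(B\otimes\varepsilon)(B\otimes\mu)(c_{B,B}\otimes B)(B\otimes\delta)(B\otimes\eta)$ and $r=(\varepsilon\otimes B)(\mu\otimes B)(B\otimes c_{B,B})(\delta\otimes B)(\eta\otimes B)$. With convolution $f\ast g=\mu(f\otimes g)\delta$, a weak Hopf monoid is a weak bimonoid $B$ for which there is $\nu:B\to B$ (the antipode) with $\nu\ast\mathrm{id}_B=t$, $\mathrm{id}_B\ast\nu=r$ and $\nu\ast\mathrm{id}_B\ast\nu=\nu$. (In (4) these definitions are applied in $(\mathcal M,\overline\otimes,K,\overline c)$.) Weak bimonad of a weak bimonoid: $T=\bullet\otimes B$ is a monad with multiplication $m=\bullet\otimes\mu$ and unit $u=\bullet\otimes\eta$, and is opmonoidal with $\tau_{X,Y}=(X\otimes c_{Y,B}\otimes B)(X\otimes Y\otimes\delta):T(X\otimes Y)\to TX\otimes TY$, $\tau_0=\varepsilon:TK\to K$; this makes $T$ a weak bimonad on $(\mathcal M,\otimes,K)$ (i.e. $\mathcal M^T$ becomes monoidal with separable Frobenius forgetful functor). Whenever $(T,m,u,\tau,\tau_0)$ is a weak bimonad on $(\mathcal M,\otimes,K)$, $(T,m,u,\overline\tau,\tau_0)$ with $\overline\tau_{X,Y}=\tau_{Y,X}$ is a weak bimonad on $(\mathcal M,\overline\otimes,K)$;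 this is the weak bimonad meant in (2). Associated data for a weak bimonad $(T,m,u,\tau,\tau_0)$ on a Cauchy complete monoidal category. For $T$-algebras $(A,a),(A',a')$ let $E_{A,A'}=(a\otimes a')\tau_{A,A'}u_{A\otimes A'}$, and for three algebras $E^{(3)}_{A,A',A''}=(a\otimes a'\otimes a'')\tau^{(3)}_{A,A',A''}u_{A\otimes A'\otimes A''}$ with $\tau^{(3)}_{X,Y,Z}=(\tau_{X,Y}\otimes TZ)\tau_{X\otimes Y,Z}$. These are idempotent. The morphism $\sqcap=(TK\otimes\tau_0)(TK\otimes m_K)\tau_{K,TK}u_{TK}:TK\to TK$ is idempotent; choose a splitting $TK\xrightarrow{P}R\xrightarrow{I}TK$, $IP=\sqcap$, $PI=\mathrm{id}_R$. Then $R$ is a $T$-algebra with action $P\circ m_K\circ TI$, and a separable Frobenius monoid with $\mu_R=(R\otimes\tau_0I)E_{R,R}$, $\eta_R=Pu_K$, $\delta_R=E_{R,R}(R\otimes Pu_K)$, $\varepsilon_R=\tau_0I$. Each $T$-algebra $A$ is an $R$-bimodule with left action $\beta_A=(\tau_0I\otimes A)E_{R,A}:R\otimes A\to A$ and two-sided action $\varrho_A=(\tau_0I\otimes A\otimes\tau_0I)E^{(3)}_{R,A,R}:R\otimes A\otimes R\to A$. Let $\lambda_X=m_X\circ T\varrho_{TX}\circ T(R\otimes u_X\otimes R):T(R\otimes X\otimes R)\to TX$ and $$F_{X,Y}=\lambda_{TX\otimes Y}\circ T(R\otimes\beta_{TX}\otimes Y\otimes R)\circ T(\delta_R\eta_R\otimes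 TX\otimes Y\otimes\eta_R):T(TX\otimes Y)\to T(TX\otimes Y),$$ an idempotent. Let $\mathsf{can}_{X,Y}=(m_X\otimes TY)\circ\tau_{TX,Y}:T(TX\otimes Y)\to TX\otimes TY$. $T$ is a right weak Hopf monad (= weak right Hopf monad) if there is a natural transformation $\chi_{X,Y}:TX\otimes TY\to T(TX\otimes Y)$ such that $\chi_{X,Y}E_{TX,TY}=\chi_{X,Y}=F_{X,Y}\chi_{X,Y}$, $\chi_{X,Y}\mathsf{can}_{X,Y}=F_{X,Y}$ and $\mathsf{can}_{X,Y}\chi_{X,Y}=E_{TX,TY}$ for all $X,Y$. A weak bimonad $(T,m,u,\tau,\tau_0)$ on a monoidal category is a left weak Hopf monad if the corresponding weak bimonad $(T,m,u,\overline\tau,\tau_0)$ on the reversed monoidal category is a right weak Hopf monad. *)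

(* Defs.v *)
From Stdlib Require Import List.
Import ListNotations.

Set Implicit Arguments.
Unset Strict Implicit.
Unset Printing Implicit Defensive.

Declare Scope moncat_scope.
Delimit Scope moncat_scope with moncat.
Local Open Scope moncat_scope.

Record category : Type := Category {
  obj :> Type;
  hom : obj -> obj -> Type;
  idm : forall X, hom X X;
  comp : forall X Y Z, hom Y Z -> hom X Y -> hom X Z;
  comp_idl : forall X Y (f : hom X Y), comp (idm Y) f = f;
  comp_idr : forall X Y (f : hom X Y), comp f (idm X) = f;
  compA : forall W X Y Z (h : hom Y Z) (g : hom X Y) (f : hom W X),
    comp h (comp g f) = comp (comp h g) f
}.
Arguments hom {c} X Y.
Arguments idm {c} X.
Arguments comp {c X Y Z} g f.

Notation "g ∘ f" := (comp g f) (at level 45, left associativity) : moncat_scope.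

Record splitting (C : category) (X : C) (e : hom X X) : Type := Splitting {
  spl_obj : C;
  spl_proj : hom X spl_obj;
  spl_incl : hom spl_obj X;
  spl_inclproj : spl_incl ∘ spl_proj = e;
  spl_projincl : spl_proj ∘ spl_incl = idm spl_obj
}.
Arguments spl_obj {C X e} s.
Arguments spl_proj {C X e} s.
Arguments spl_incl {C X e} s.

Definition cauchy_complete (C : category) : Prop :=
  forall (X : C) (e : hom X X), e ∘ e = e -> inhabited (splitting e).

Record monoidal : Type := Monoidal {
  mcat :> category;
  tens : mcat -> mcat -> mcat;
  munit : mcat;
  tensh : forall X X' Y Y' : mcat,
    hom X X' -> hom Y Y' -> hom (tens X Y) (tens X' Y');
  assoc : forall X Y Z : mcat, hom (tens (tens X Y) Z) (tens X (tens Y Z));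
  associ : forall X Y Z : mcat, hom (tens X (tens Y Z)) (tens (tens X Y) Z);
  lunit : forall X : mcat, hom (tens munit X) X;
  luniti : forall X : mcat, hom X (tens munit X);
  runit : forall X : mcat, hom (tens X munit) X;
  runiti : forall X : mcat, hom X (tens X munit);
  tensh_id : forall X Y : mcat, tensh (idm X) (idm Y) = idm (tens X Y);
  tensh_comp : forall (X X' X'' Y Y' Y'' : mcat)
    (f' : hom X' X'') (f : hom X X') (g' : hom Y' Y'') (g : hom Y Y'),
    tensh (f' ∘ f) (g' ∘ g) = tensh f' g' ∘ tensh f g;
  assoc_nat : forall (X X' Y Y' Z Z' : mcat)
    (f : hom X X') (g : hom Y Y') (h : hom Z Z'),
    assoc X' Y' Z' ∘ tensh (tensh f g) h = tensh f (tensh g h) ∘ assoc X Y Z;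
  lunit_nat : forall (X X' : mcat) (f : hom X X'),
    lunit X' ∘ tensh (idm munit) f = f ∘ lunit X;
  runit_nat : forall (X X' : mcat) (f : hom X X'),
    runit X' ∘ tensh f (idm munit) = f ∘ runit X;
  assocK : forall X Y Z : mcat, associ X Y Z ∘ assoc X Y Z = idm _;
  associK : forall X Y Z : mcat, assoc X Y Z ∘ associ X Y Z = idm _;
  lunitK : forall X : mcat, luniti X ∘ lunit X = idm _;
  lunitiK : forall X : mcat, lunit X ∘ luniti X = idm _;
  runitK : forall X : mcat, runiti X ∘ runit X = idm _;
  runitiK : forall X : mcat, runit X ∘ runiti X = idm _;
  pentagon : forall W X Y Z : mcat,
    assoc W X (tens Y Z) ∘ assoc (tens W X) Y Z
    = tensh (idm W) (assoc X Y Z) ∘ assoc W (tens X Y) Z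
      ∘ tensh (assoc W X Y) (idm Z);
  triangle : forall X Y : mcat,
    tensh (idm X) (lunit Y) ∘ assoc X munit Y = tensh (runit X) (idm Y)
}.
Arguments tens {m} X Y.
Arguments munit {m}.
Arguments tensh {m X X' Y Y'} f g.
Arguments assoc {m} X Y Z.
Arguments associ {m} X Y Z.
Arguments lunit {m} X.
Arguments luniti {m} X.
Arguments runit {m} X.
Arguments runiti {m} X.

Record braided : Type := Braided {
  bmon :> monoidal;
  br : forall X Y : bmon, hom (tens X Y) (tens Y X);
  bri : forall X Y : bmon, hom (tens Y X) (tens X Y);
  brK : forall X Y : bmon, bri X Y ∘ br X Y = idm _;
  briK : forall X Y : bmon, br X Y ∘ bri X Y = idm _;
  br_nat : forall (X X' Y Y' : bmon) (f : hom X X') (g : hom Y Y'),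
    br X' Y' ∘ tensh f g = tensh g f ∘ br X Y;
  hexagon1 : forall X Y Z : bmon,
    assoc Y Z X ∘ br X (tens Y Z) ∘ assoc X Y Z
    = tensh (idm Y) (br X Z) ∘ assoc Y X Z ∘ tensh (br X Y) (idm Z);
  hexagon2 : forall X Y Z : bmon,
    associ Z X Y ∘ br (tens X Y) Z ∘ associ X Y Z
    = tensh (br X Z) (idm Y) ∘ associ X Z Y ∘ tensh (idm X) (br Y Z)
}.
Arguments br {b} X Y.
Arguments bri {b} X Y.

Section Reverse.

Lemma comp_inj (C : category) (X Y X' Y' : C)
    (p : hom Y Y') (p' : hom Y' Y) (q : hom X X') (q' : hom X' X)
    (f g : hom X' Y) :
  p' ∘ p = idm Y -> q ∘ q' = idm X' -> p ∘ f ∘ q = p ∘ g ∘ q -> f = g.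
Proof.
  intros Hp Hq H.
  rewrite <- (comp_idl f), <- (comp_idl g), <- Hp, <- !compA.
  rewrite <- (comp_idr f), <- (comp_idr g), <- Hq, (compA f), (compA g).
  now rewrite !(compA p), !H.
Qed.

Variable M : monoidal.

Lemma tensh_inv (X X' Y Y' : M) (f : hom X X') (f' : hom X' X)
    (g : hom Y Y') (g' : hom Y' Y) :
  f' ∘ f = idm X -> g' ∘ g = idm Y -> tensh f' g' ∘ tensh f g = idm _.
Proof. intros Hf Hg. now rewrite <- tensh_comp, Hf, Hg, tensh_id. Qed.

Lemma associ_nat (X X' Y Y' Z Z' : M)
    (f : hom X X') (g : hom Y Y') (h : hom Z Z') :
  associ X' Y' Z' ∘ tensh f (tensh g h) = tensh (tensh f g) h ∘ associ X Y Z.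
Proof.
  apply (comp_inj (p := assoc X' Y' Z') (q := assoc X Y Z)
    (assocK _ _ _) (associK _ _ _)).
  rewrite compA, associK, comp_idl.
  rewrite <- (compA (assoc X' Y' Z')), <- (compA (tensh (tensh f g) h)).
  now rewrite assocK, comp_idr, assoc_nat.
Qed.

Lemma pentagon_inv (W X Y Z : M) :
  associ (tens W X) Y Z ∘ associ W X (tens Y Z)
  = tensh (associ W X Y) (idm Z) ∘ associ W (tens X Y) Z
    ∘ tensh (idm W) (associ X Y Z).
Proof.
  set (a1 := assoc W X (tens Y Z)). set (a2 := assoc (tens W X) Y Z).
  set (b1 := associ W X (tens Y Z)). set (b2 := associ (tens W X) Y Z).
  assert (H1 : (b2 ∘ b1) ∘ (a1 ∘ a2) = idm _).
  { rewrite compA, <- (compA b2), (assocK W X (tens Y Z) : b1 ∘ a1 = _), comp_idr.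
    apply assocK. }
  assert (H2 : (a1 ∘ a2) ∘ (b2 ∘ b1) = idm _).
  { rewrite compA, <- (compA a1), (associK (tens W X) Y Z : a2 ∘ b2 = _), comp_idr.
    apply associK. }
  apply (comp_inj H1 H2).
  rewrite H2, comp_idl.
  match goal with |- _ = _ ∘ ?r ∘ _ =>
    enough (H3 : (a1 ∘ a2) ∘ r = idm _) by now rewrite H3, comp_idl end.
  unfold a1, a2. rewrite pentagon, !compA.
  rewrite <- (compA _ (tensh (assoc W X Y) (idm Z))
                      (tensh (associ W X Y) (idm Z))).
  rewrite (tensh_inv (associK _ _ _) (comp_idl _)), comp_idr.
  rewrite <- (compA _ (assoc W (tens X Y) Z)), associK, comp_idr.
  apply (tensh_inv (comp_idl _) (associK _ _ _)).
Qed.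

Lemma triangle_inv (X Y : M) :
  tensh (runit X) (idm Y) ∘ associ X munit Y = tensh (idm X) (lunit Y).
Proof. now rewrite <- triangle, <- compA, associK, comp_idr. Qed.

End Reverse.

Definition rev_monoidal (M : monoidal) : monoidal :=
  @Monoidal (mcat M)
    (fun X Y => tens Y X)
    munit
    (fun X X' Y Y' f g => tensh g f)
    (fun X Y Z => associ Z Y X)
    (fun X Y Z => assoc Z Y X)
    (fun X => runit X) (fun X => runiti X)
    (fun X => lunit X) (fun X => luniti X)
    (fun X Y => tensh_id Y X)
    (fun X X' X'' Y Y' Y'' f' f g' g => tensh_comp g' g f' f)
    (fun X X' Y Y' Z Z' f g h => associ_nat h g f)
    (fun X X' f => runit_nat f)
    (fun X X' f => lunit_nat f)
    (fun X Y Z => associK Z Y X)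
    (fun X Y Z => assocK Z Y X)
    (fun X => runitK X) (fun X => runitiK X)
    (fun X => lunitK X) (fun X => lunitiK X)
    (fun W X Y Z => pentagon_inv Z Y X W)
    (fun X Y => triangle_inv Y X).

Definition rev_braided (M : braided) : braided :=
  @Braided (rev_monoidal M)
    (fun X Y => br Y X)
    (fun X Y => bri Y X)
    (fun X Y => brK Y X)
    (fun X Y => briK Y X)
    (fun X X' Y Y' f g => br_nat g f)
    (fun X Y Z => hexagon2 Z Y X)
    (fun X Y Z => hexagon1 Z Y X).

(* A morphism [l ⇒ l'] between lists of objects is a morphism of [M] between
  their right-nested tensor products: [⟦[X; Y; Z]⟧ = X ⊗ (Y ⊗ Z)],
  [⟦[X]⟧ = X] and [⟦[]⟧ = K] (definitionally).  The tensor product of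
  [f : l1 ⇒ l1'] and [g : l2 ⇒ l2'] goes from [l1 ++ l2] to [l1' ++ l2'];
  it is the tensor product of [M] conjugated by the canonical isomorphisms
  [⟦l⟧ ⊗ ⟦m⟧ ≅ ⟦l ++ m⟧] built from associators and unitors.  For lists of
  known length the concatenations compute, so formulas that suppress the
  coherence isomorphisms can be written verbatim. *)

Section Lists.
Variable M : monoidal.

Fixpoint tensl (l : list M) : M :=
  match l with
  | [] => munit
  | X :: l' => match l' with [] => X | _ :: _ => tens X (tensl l') end
  end.

Fixpoint joinl (l m : list M) : hom (tens (tensl l) (tensl m)) (tensl (l ++ m)) :=
  match l with
  | [] => lunit (tensl m)
  | X :: l' =>
    match l' return
      hom (tens (tensl l') (tensl m)) (tensl (l' ++ m)) ->
      hom (tens (tensl (X :: l')) (tensl m)) (tensl ((X :: l') ++ m))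
    with
    | [] => fun _ =>
      match m return hom (tens X (tensl m)) (tensl (X :: m)) with
      | [] => runit X
      | Y :: m' => idm (tens X (tensl (Y :: m')))
      end
    | Y :: l'' => fun rec =>
      tensh (idm X) rec ∘ assoc X (tensl (Y :: l'')) (tensl m)
    end (joinl l' m)
  end.

Fixpoint splitl (l m : list M) : hom (tensl (l ++ m)) (tens (tensl l) (tensl m)) :=
  match l with
  | [] => luniti (tensl m)
  | X :: l' =>
    match l' return
      hom (tensl (l' ++ m)) (tens (tensl l') (tensl m)) ->
      hom (tensl ((X :: l') ++ m)) (tens (tensl (X :: l')) (tensl m))
    with
    | [] => fun _ =>
      match m return hom (tensl (X :: m)) (tens X (tensl m)) with
      | [] => runiti X
      | Y :: m' => idm (tens X (tensl (Y :: m')))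
      end
    | Y :: l'' => fun rec =>
      associ X (tensl (Y :: l'')) (tensl m) ∘ tensh (idm X) rec
    end (splitl l' m)
  end.

Lemma joinlK (l m : list M) : splitl l m ∘ joinl l m = idm _.
Proof.
  induction l as [|X [|Y l] IH].
  - apply lunitK.
  - destruct m; [apply runitK | apply comp_idl].
  - change (associ X (tensl (Y :: l)) (tensl m)
      ∘ tensh (idm X) (splitl (Y :: l) m)
      ∘ (tensh (idm X) (joinl (Y :: l) m)
         ∘ assoc X (tensl (Y :: l)) (tensl m)) = idm _).
    rewrite compA, <- (compA (associ _ _ _)).
    rewrite (tensh_inv (comp_idl _) IH), comp_idr.
    apply assocK.
Qed.

Lemma splitlK (l m : list M) : joinl l m ∘ splitl l m = idm _.
Proof.
  induction l as [|X [|Y l] IH].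
  - apply lunitiK.
  - destruct m; [apply runitiK | apply comp_idl].
  - change (tensh (idm X) (joinl (Y :: l) m)
      ∘ assoc X (tensl (Y :: l)) (tensl m)
      ∘ (associ X (tensl (Y :: l)) (tensl m)
         ∘ tensh (idm X) (splitl (Y :: l) m)) = idm _).
    rewrite compA, <- (compA (tensh _ _) (assoc _ _ _)).
    rewrite associK, comp_idr.
    apply (tensh_inv (comp_idl _) IH).
Qed.

Definition mhom (l m : list M) : Type := hom (tensl l) (tensl m).

Definition mcomp (l m n : list M) (g : mhom m n) (f : mhom l m) : mhom l n :=
  comp g f.

Definition mid (X : M) : mhom [X] [X] := idm X.

Definition mtens (l1 l1' l2 l2' : list M) (f : mhom l1 l1') (g : mhom l2 l2') :
    mhom (l1 ++ l2) (l1' ++ l2') :=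
  joinl l1' l2' ∘ tensh f g ∘ splitl l1 l2.

End Lists.
Arguments tensl {M} l.
Arguments joinl {M} l m.
Arguments splitl {M} l m.
Arguments mhom {M} l m.
Arguments mcomp {M l m n} g f.
Arguments mid {M} X.
Arguments mtens {M l1 l1' l2 l2'} f g.

Notation "⟦ l ⟧" := (tensl l) (at level 0, format "⟦ l ⟧") : moncat_scope.
Notation "l ⇒ m" := (mhom l m) (at level 70, no associativity) : moncat_scope.
Notation "g • f" := (mcomp g f) (at level 45, left associativity) : moncat_scope.
Notation "f ⊗ g" := (mtens f g) (at level 40, left associativity) : moncat_scope.
Notation "⟨ X ⟩" := (mid X) (at level 0, format "⟨ X ⟩") : moncat_scope.

Record bimonoid_data (M : monoidal) : Type := BimonoidData {
  bm_obj :> M;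
  bm_mul : [bm_obj; bm_obj] ⇒ [bm_obj];
  bm_unit : [] ⇒ [bm_obj];
  bm_comul : [bm_obj] ⇒ [bm_obj; bm_obj];
  bm_counit : [bm_obj] ⇒ []
}.

Definition mbr (M : braided) (X Y : M) : [X; Y] ⇒ [Y; X] := br X Y.
Definition mbri (M : braided) (X Y : M) : [Y; X] ⇒ [X; Y] := bri X Y.

Section WeakHopfMonoid.
Variables (M : braided) (D : bimonoid_data M).

Let B : M := bm_obj D.
Let μ : [B; B] ⇒ [B] := bm_mul D.
Let η : [] ⇒ [B] := bm_unit D.
Let δ : [B] ⇒ [B; B] := bm_comul D.
Let ε : [B] ⇒ [] := bm_counit D.
Let c : [B; B] ⇒ [B; B] := mbr B B.
Let c' : [B; B] ⇒ [B; B] := mbri B B.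
Let id : [B] ⇒ [B] := mid B.

Record is_weak_bimonoid : Prop := IsWeakBimonoid {
  wb_mulA : μ • (μ ⊗ id) = μ • (id ⊗ μ);
  wb_mul1l : μ • (η ⊗ id) = id;
  wb_mul1r : μ • (id ⊗ η) = id;
  wb_comulA : (δ ⊗ id) • δ = (id ⊗ δ) • δ;
  wb_comul1l : (ε ⊗ id) • δ = id;
  wb_comul1r : (id ⊗ ε) • δ = id;
  wb_b : δ • μ = (μ ⊗ μ) • (id ⊗ c ⊗ id) • (δ ⊗ δ);
  wb_v1 : ε • μ • (μ ⊗ id) = (ε ⊗ ε) • (μ ⊗ μ) • (id ⊗ δ ⊗ id);
  wb_v2 : ε • μ • (μ ⊗ id) = (ε ⊗ ε) • (μ ⊗ μ) • (id ⊗ (c' • δ) ⊗ id);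
  wb_w1 : (δ ⊗ id) • δ • η = (id ⊗ μ ⊗ id) • (δ ⊗ δ) • (η ⊗ η);
  wb_w2 : (δ ⊗ id) • δ • η = (id ⊗ (μ • c') ⊗ id) • (δ ⊗ δ) • (η ⊗ η)
}.

Definition wb_t : [B] ⇒ [B] :=
  (id ⊗ ε) • (id ⊗ μ) • (c ⊗ id) • (id ⊗ δ) • (id ⊗ η).

Definition wb_r : [B] ⇒ [B] :=
  (ε ⊗ id) • (μ ⊗ id) • (id ⊗ c) • (δ ⊗ id) • (η ⊗ id).

Definition convolution (f g : [B] ⇒ [B]) : [B] ⇒ [B] := μ • (f ⊗ g) • δ.

Definition is_antipode (ν : [B] ⇒ [B]) : Prop :=
  convolution ν id = wb_t /\
  convolution id ν = wb_r /\
  convolution (convolution ν id) ν = ν.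

Definition is_weak_Hopf_monoid : Prop :=
  is_weak_bimonoid /\ exists ν : [B] ⇒ [B], is_antipode ν.

End WeakHopfMonoid.

Definition rev_bimonoid (M : monoidal) (D : bimonoid_data M) :
    bimonoid_data (rev_monoidal M) :=
  @BimonoidData (rev_monoidal M) (bm_obj D)
    (bm_mul D) (bm_unit D) (bm_comul D) (bm_counit D).

(* The structure maps of a weak bimonad.  The laws of a weak bimonad are not
  recorded: they are consequences of the weak bimonoid axioms for the maps
  built in [tensor_weak_bimonad] and in its reverse, and the definition of a
  weak Hopf monad is a condition on the structure maps of a weak bimonad. *)

Record weak_bimonad_data (M : monoidal) : Type := WeakBimonadData {
  wm_obj :> M -> M;
  wm_map : forall X Y : M, [X] ⇒ [Y] -> [wm_obj X] ⇒ [wm_obj Y];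
  wm_mul : forall X : M, [wm_obj (wm_obj X)] ⇒ [wm_obj X];
  wm_unit : forall X : M, [X] ⇒ [wm_obj X];
  wm_tau : forall X Y : M, [wm_obj (tens X Y)] ⇒ [wm_obj X; wm_obj Y];
  wm_tau0 : [wm_obj munit] ⇒ []
}.
Arguments wm_map {M} w {X Y} f.
Arguments wm_mul {M} w X.
Arguments wm_unit {M} w X.
Arguments wm_tau {M} w X Y.
Arguments wm_tau0 {M} w.

Section WeakHopfMonad.
Variables (M : monoidal) (T : weak_bimonad_data M).

Definition Tm (l l' : list M) (f : l ⇒ l') : [T ⟦l⟧] ⇒ [T ⟦l'⟧] :=
  wm_map T (X := ⟦l⟧) (Y := ⟦l'⟧) f.
Definition Tu (l : list M) : l ⇒ [T ⟦l⟧] := wm_unit T ⟦l⟧.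
Definition Tτ (l l' : list M) : [T ⟦l ++ l'⟧] ⇒ [T ⟦l⟧; T ⟦l'⟧] :=
  wm_tau T ⟦l⟧ ⟦l'⟧
  • wm_map T (X := ⟦l ++ l'⟧) (Y := tens ⟦l⟧ ⟦l'⟧) (splitl l l').

Let K : M := munit.
Let m (X : M) : [T (T X)] ⇒ [T X] := wm_mul T X.
Let τ0 : [T K] ⇒ [] := wm_tau0 T.

Definition Tτ3 (l l' l'' : list M) :
    [T ⟦(l ++ l') ++ l''⟧] ⇒ [T ⟦l⟧; T ⟦l'⟧; T ⟦l''⟧] :=
  (Tτ l l' ⊗ ⟨T ⟦l''⟧⟩) • Tτ (l ++ l') l''.

Definition wm_E (A A' : M) (a : [T A] ⇒ [A]) (a' : [T A'] ⇒ [A']) :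
    [A; A'] ⇒ [A; A'] :=
  (a ⊗ a') • Tτ [A] [A'] • Tu [A; A'].

Definition wm_E3 (A A' A'' : M)
    (a : [T A] ⇒ [A]) (a' : [T A'] ⇒ [A']) (a'' : [T A''] ⇒ [A'']) :
    [A; A'; A''] ⇒ [A; A'; A''] :=
  (a ⊗ a' ⊗ a'') • Tτ3 [A] [A'] [A''] • Tu [A; A'; A''].

Definition wm_sqcap : [T K] ⇒ [T K] :=
  (⟨T K⟩ ⊗ τ0) • (⟨T K⟩ ⊗ m K) • Tτ [] [T K] • Tu [T K].

Section Base.
Variable S : splitting (X := T K) wm_sqcap.

Let R : M := spl_obj S.
Let P : [T K] ⇒ [R] := spl_proj S.
Let I : [R] ⇒ [T K] := spl_incl S.

Definition R_act : [T R] ⇒ [R] := P • m K • Tm I.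

Definition R_mul : [R; R] ⇒ [R] := (⟨R⟩ ⊗ (τ0 • I)) • wm_E R_act R_act.
Definition R_unit : [] ⇒ [R] := P • Tu [].
Definition R_comul : [R] ⇒ [R; R] := wm_E R_act R_act • (⟨R⟩ ⊗ (P • Tu [])).
Definition R_counit : [R] ⇒ [] := τ0 • I.

Definition wm_beta (A : M) (a : [T A] ⇒ [A]) : [R; A] ⇒ [A] :=
  ((τ0 • I) ⊗ ⟨A⟩) • wm_E R_act a.

Definition wm_rho (A : M) (a : [T A] ⇒ [A]) : [R; A; R] ⇒ [A] :=
  ((τ0 • I) ⊗ ⟨A⟩ ⊗ (τ0 • I)) • wm_E3 R_act a R_act.

Definition wm_lambda (l : list M) : [T ⟦[R] ++ l ++ [R]⟧] ⇒ [T ⟦l⟧] :=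
  m ⟦l⟧ • Tm (wm_rho (m ⟦l⟧)) • Tm (⟨R⟩ ⊗ Tu l ⊗ ⟨R⟩).

Definition wm_F (X Y : M) : [T ⟦[T X; Y]⟧] ⇒ [T ⟦[T X; Y]⟧] :=
  wm_lambda [T X; Y]
  • Tm (⟨R⟩ ⊗ wm_beta (m X) ⊗ ⟨Y⟩ ⊗ ⟨R⟩)
  • Tm ((R_comul • R_unit) ⊗ ⟨T X⟩ ⊗ ⟨Y⟩ ⊗ R_unit).

End Base.

Definition wm_can (X Y : M) : [T ⟦[T X; Y]⟧] ⇒ [T X; T Y] :=
  (m X ⊗ ⟨T Y⟩) • Tτ [T X] [Y].

Definition wm_chi_natural
    (χ : forall X Y : M, [T X; T Y] ⇒ [T ⟦[T X; Y]⟧]) : Prop :=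
  forall (X X' Y Y' : M) (f : [X] ⇒ [X']) (g : [Y] ⇒ [Y']),
    χ X' Y' • (Tm f ⊗ Tm g) = Tm (Tm f ⊗ g) • χ X Y.

(* The object [R] is only determined up to isomorphism: any splitting of
   the idempotent may be chosen. *)
Definition is_right_weak_Hopf_monad : Prop :=
  exists (S : splitting (X := T K) wm_sqcap)
         (χ : forall X Y : M, [T X; T Y] ⇒ [T ⟦[T X; Y]⟧]),
    wm_chi_natural χ /\
    forall X Y : M,
      χ X Y • wm_E (m X) (m Y) = χ X Y /\
      wm_F S X Y • χ X Y = χ X Y /\
      χ X Y • wm_can X Y = wm_F S X Y /\
      wm_can X Y • χ X Y = wm_E (m X) (m Y).

End WeakHopfMonad.

Definition rev_weak_bimonad (M : monoidal) (T : weak_bimonad_data M) :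
    weak_bimonad_data (rev_monoidal M) :=
  @WeakBimonadData (rev_monoidal M) (wm_obj T)
    (fun X Y f => wm_map T (X := X) (Y := Y) f)
    (wm_mul T)
    (wm_unit T)
    (fun X Y => wm_tau T Y X)
    (wm_tau0 T).

Definition is_left_weak_Hopf_monad (M : monoidal) (T : weak_bimonad_data M) :
    Prop :=
  is_right_weak_Hopf_monad (rev_weak_bimonad T).

(* [joinl] and [splitl] rebracket the objects [T X = X ⊗ B], for example
   [(X ⊗ B) ⊗ B ≅ X ⊗ (B ⊗ B)]. *)
Definition tensor_weak_bimonad (M : braided) (D : bimonoid_data M) :
    weak_bimonad_data M :=
  let B := bm_obj D in
  @WeakBimonadData M
    (fun X => ⟦[X; B]⟧)
    (fun X Y f => f ⊗ ⟨B⟩)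
    (fun X => (⟨X⟩ ⊗ bm_mul D) • (joinl [X; B] [B] : [⟦[⟦[X; B]⟧; B]⟧] ⇒ [X; B; B]))
    (fun X => ⟨X⟩ ⊗ bm_unit D)
    (fun X Y =>
      (splitl [X; B] [Y; B] : [X; B; Y; B] ⇒ [⟦[X; B]⟧; ⟦[Y; B]⟧])
      • (⟨X⟩ ⊗ mbr Y B ⊗ ⟨B⟩)
      • (⟨X⟩ ⊗ ⟨Y⟩ ⊗ bm_comul D)
      • (joinl [X; Y] [B] : [⟦[⟦[X; Y]⟧; B]⟧] ⇒ [X; Y; B]))
    (bm_counit D • (joinl [] [B] : [⟦[munit; B]⟧] ⇒ [B])).

(* Main.v *)
Require Import Defs.
From Stdlib Require Import List ssreflect.
Import ListNotations.

(* In Sweedler notation let [Φ_f (b ⊗ b') = b f(b'_1) ⊗ b'_2] for an endomorphism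
  [f] of [B]; then [Φ_f Φ_g = Φ_(g ∗ f)] and [f] is recovered as
  [(B ⊗ ε) Φ_f (η ⊗ B)].  Up to rebracketing and the crossing of [Y] with [B],
  [can] is [Φ_id]; [E] is [Φ_t] because [t(b_1) ⊗ b_2 = 1_1 ⊗ b 1_2]; and [F] is
  [Φ_r] because [r(b_1) ⊗ b_2 = r(1_1) ⊗ 1_2 b].  Hence an antipode [ν] yields
  [χ = Φ_ν].  Conversely [χ_(K,K)] is a partial inverse of the left [B]-linear and
  right [B]-colinear [can_(K,K)], so it inherits both properties and is therefore
  [Φ_ν] for some [ν], which is an antipode.  The reversal of the tensor product
  exchanges [t] with [r] and [f ∗ g] with [g ∗ f].

  Diagrams are compositions of layers [X1 ◁ ... ◁ (f ▷ p)] with [f] a generator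
  and [p] an arbitrary list of strands to its right: [l ++ p] computes for a
  concrete [l] and a variable [p], so every coherence isomorphism is an identity
  by conversion. *)

(** Two obstacles shape the computation. The idempotent F is defined through an arbitrary splitting
    R of the idempotent on TK, which is t under TK ≅ B. R is removed by letting each projection B →
    R meet an inclusion R → B: the composite is t, and t is absorbed by ε, by η and by the left
    argument of the pairing ε(b b'). For these facts on t the inverse braiding in the second halves
    of (v) and (w) is essential, since it cancels the crossing built into t; the facts on r rest on
    the first halves. The other obstacle is reversal. Reversing the bimonad twice restores its
    structure maps, so (1) and (2) agree by conversion. For (3) and (4) conversion does not suffice:
    a list of objects is bracketed to the right, which in the reversed category means to the left in
    M, and axioms with three strands are affected. Diagrams are therefore carried across by a
    faithful mirror operation on list morphisms. *)

Set Implicit Arguments.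
Unset Strict Implicit.
Unset Printing Implicit Defensive.
Local Open Scope moncat_scope.

(** * Unit coherence *)

Section Kelly.
Variable M : monoidal.
Local Notation K := (munit (m := M)).

Lemma epi_cancel (C : category) (X Y Z : C) (q : hom X Y) (q' : hom Y X)
    (f g : hom Y Z) : q ∘ q' = idm Y -> f ∘ q = g ∘ q -> f = g.
Proof.
  intros Hq H. rewrite -(comp_idr f) -(comp_idr g) -Hq !compA.
  now rewrite H.
Qed.

Lemma mono_cancel (C : category) (X Y Z : C) (q : hom Y Z) (q' : hom Z Y)
    (f g : hom X Y) : q' ∘ q = idm Y -> q ∘ f = q ∘ g -> f = g.
Proof.
  intros Hq H. rewrite -(comp_idl f) -(comp_idl g) -Hq -!compA.
  now rewrite H.
Qed.

Lemma munit_tens_faithful (X Y : M) (f g : hom X Y) :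
  tensh (idm K) f = tensh (idm K) g -> f = g.
Proof.
  intros H. apply (epi_cancel (lunitiK X)). now rewrite -!lunit_nat H.
Qed.

Lemma tens_munit_faithful (X Y : M) (f g : hom X Y) :
  tensh f (idm K) = tensh g (idm K) -> f = g.
Proof.
  intros H. apply (epi_cancel (runitiK X)). now rewrite -!runit_nat H.
Qed.

Lemma tensh_compl (X Y Y' Y'' : M) (g : hom Y' Y'') (f : hom Y Y') :
  tensh (idm X) (g ∘ f) = tensh (idm X) g ∘ tensh (idm X) f.
Proof. now rewrite -tensh_comp comp_idl. Qed.

Lemma tensh_compr (X Y Y' Y'' : M) (g : hom Y' Y'') (f : hom Y Y') :
  tensh (g ∘ f) (idm X) = tensh g (idm X) ∘ tensh f (idm X).
Proof. now rewrite -tensh_comp comp_idl. Qed.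

Lemma lunit_tens (X Y : M) :
  lunit (tens X Y) ∘ assoc K X Y = tensh (lunit X) (idm Y).
Proof.
  apply munit_tens_faithful.
  apply (epi_cancel (associK K (tens K X) Y)).
  assert (Hi : tensh (assoc K K X) (idm Y) ∘ tensh (associ K K X) (idm Y) = idm _).
  { now rewrite -tensh_comp associK comp_idl tensh_id. }
  apply (epi_cancel Hi).
  rewrite tensh_compl -!compA (compA (tensh _ (assoc _ _ _))) -pentagon.
  rewrite compA triangle -tensh_id -assoc_nat.
  rewrite (compA (tensh _ _) (assoc _ _ _)) -assoc_nat -compA.
  now rewrite -tensh_compr triangle.
Qed.

End Kelly.

Lemma runit_tens (M : monoidal) (X Y : M) :
  runit (tens X Y) ∘ associ X Y munit = tensh (idm X) (runit Y).
Proof. exact (lunit_tens (M := rev_monoidal M) Y X). Qed.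

Lemma runit_tens' (M : monoidal) (X Y : M) :
  tensh (idm X) (runit Y) ∘ assoc X Y munit = runit (tens X Y).
Proof. now rewrite -runit_tens -compA assocK comp_idr. Qed.

(** Naturality of λ at λ_K gives λ_(K ⊗ K) = K ⊗ λ_K; with [lunit_tens] and the triangle this
    identifies λ_K ⊗ K with ρ_K ⊗ K. *)
Lemma lunit_munit (M : monoidal) : lunit (munit (m := M)) = runit munit.
Proof.
  apply tens_munit_faithful. rewrite -lunit_tens -triangle. f_equal.
  apply (mono_cancel (lunitK munit)). now rewrite lunit_nat.
Qed.

(** Both sides are compared after tensoring with K and composing with the invertible λ_X ∘ c:
    triangles and naturality of the braiding reduce the claim to the hexagon for X, K, K. *)
Lemma lunit_br (M : braided) (X : M) : lunit X ∘ br X munit = runit X.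
Proof.
  symmetry. apply tens_munit_faithful.
  assert (Hi : bri X munit ∘ luniti X ∘ (lunit X ∘ br X munit) = idm _).
  { rewrite compA -(compA _ (luniti X)) lunitK comp_idr. apply brK. }
  apply (mono_cancel Hi).
  rewrite tensh_compr -(lunit_tens X munit).
  transitivity (lunit X ∘ (tensh (idm munit) (lunit X)
    ∘ (assoc munit munit X ∘ br X (tens munit munit) ∘ assoc X munit munit))).
  - rewrite -!compA. f_equal.
    rewrite (compA (tensh _ _)) triangle -lunit_munit.
    rewrite (compA (tensh _ _)) -br_nat -compA. f_equal.
    now rewrite triangle.
  - rewrite hexagon1 !compA. f_equal. f_equal.
    rewrite -compA -tensh_compl. apply lunit_nat.
Qed.

Lemma runit_br (M : braided) (X : M) : runit X ∘ br munit X = lunit X.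
Proof. exact (lunit_br (M := rev_braided M) X). Qed.

(** * A strict calculus on lists of objects *)

Section ListCalculus.
Variable M : monoidal.
Implicit Types l m n p q : list M.

(** A transparent recursion, because transports along it must vanish by computation on concrete
    lists. *)
Fixpoint appA l m n : (l ++ m) ++ n = l ++ (m ++ n) :=
  match l with
  | [] => eq_refl
  | X :: l' => f_equal (cons X) (appA l' m n)
  end.

Fixpoint app0 l : l ++ [] = l :=
  match l with
  | [] => eq_refl
  | X :: l' => f_equal (cons X) (app0 l')
  end.

Definition castl l m (e : l = m) : l ⇒ m :=
  match e in _ = m return l ⇒ m with eq_refl => idm ⟦l⟧ end.

Lemma castl_cons X l m (e : l = m) :
  castl (f_equal (cons X) e)
  = joinl [X] m ∘ tensh (idm X) (castl e) ∘ splitl [X] l.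
Proof.
  destruct e. cbn [castl f_equal]. rewrite tensh_id comp_idr.
  symmetry. apply (splitlK [X] l).
Qed.

(** Together with [join0] this makes [joinl] a monoidal comparison from lists under concatenation to
    M. The induction step is the pentagon; for [l] with at most one object, [lunit_tens] or the
    triangle intervenes. *)
Lemma joinA l m n :
  castl (appA l m n) ∘ joinl (l ++ m) n ∘ tensh (joinl l m) (idm ⟦n⟧)
  = joinl l (m ++ n) ∘ tensh (idm ⟦l⟧) (joinl m n) ∘ assoc ⟦l⟧ ⟦m⟧ ⟦n⟧.
Proof.
  induction l as [|X [|Y l] IH].
  - cbn [app joinl appA castl tensl]. rewrite comp_idl lunit_nat -compA.
    now rewrite lunit_tens.
  - destruct m as [|Y m]; cbn [app joinl appA castl tensl f_equal].
    + rewrite comp_idl -compA triangle. reflexivity.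
    + rewrite !comp_idl tensh_id comp_idr. reflexivity.
  - set (e := appA (Y :: l) m n) in *.
    change (castl (f_equal (cons X) e)
      ∘ (tensh (idm X) (joinl (Y :: l ++ m) n) ∘ assoc X ⟦Y :: l ++ m⟧ ⟦n⟧)
      ∘ tensh (tensh (idm X) (joinl (Y :: l) m) ∘ assoc X ⟦Y :: l⟧ ⟦m⟧) (idm ⟦n⟧)
      = tensh (idm X) (joinl (Y :: l) (m ++ n)) ∘ assoc X ⟦Y :: l⟧ ⟦m ++ n⟧
        ∘ tensh (idm (tens X ⟦Y :: l⟧)) (joinl m n)
        ∘ assoc (tens X ⟦Y :: l⟧) ⟦m⟧ ⟦n⟧).
    assert (He : castl (f_equal (cons X) e) = tensh (idm X) (castl e)).
    { rewrite castl_cons. cbn [app joinl splitl]. now rewrite comp_idl comp_idr. }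
    rewrite He.
    rewrite tensh_compr !compA.
    rewrite -(compA _ (assoc X _ _) (tensh (tensh _ _) _)) assoc_nat !compA.
    apply (f_equal (tensh (idm X))) in IH. rewrite !tensh_compl in IH.
    etransitivity.
    { exact (f_equal (fun z => z ∘ assoc X (tens ⟦Y :: l⟧ ⟦m⟧) ⟦n⟧
        ∘ tensh (assoc X ⟦Y :: l⟧ ⟦m⟧) (idm ⟦n⟧)) IH). }
    rewrite -!compA.
    rewrite (compA (tensh _ (assoc _ _ _))) -pentagon.
    f_equal. rewrite !compA. f_equal.
    rewrite -tensh_id. symmetry. apply assoc_nat.
Qed.

Lemma join0 l : castl (app0 l) ∘ joinl l [] = runit ⟦l⟧.
Proof.
  induction l as [|X [|Y l] IH].
  - cbn. rewrite comp_idl. apply lunit_munit.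
  - cbn. apply comp_idl.
  - set (e := app0 (Y :: l)) in *.
    change (castl (f_equal (cons X) e)
      ∘ (tensh (idm X) (joinl (Y :: l) []) ∘ assoc X ⟦Y :: l⟧ munit)
      = runit (tens X ⟦Y :: l⟧)).
    rewrite castl_cons. cbn [app joinl splitl]. rewrite comp_idl comp_idr compA.
    etransitivity.
    { refine (f_equal (fun z => z ∘ assoc X ⟦Y :: l⟧ munit) _).
      symmetry. apply (tensh_compl X (castl e) (joinl (Y :: l) [])). }
    rewrite IH. apply runit_tens'.
Qed.

(** * Strict monoidal laws for list morphisms *)

Definition lid l : l ⇒ l := idm ⟦l⟧.

Lemma mcompA l m n p (h : n ⇒ p) (g : m ⇒ n) (f : l ⇒ m) :
  h • g • f = h • (g • f).
Proof. symmetry. apply compA. Qed.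

Lemma mcomp1f l m (f : l ⇒ m) : lid m • f = f.
Proof. apply comp_idl. Qed.

Lemma mcompf1 l m (f : l ⇒ m) : f • lid l = f.
Proof. apply comp_idr. Qed.

Lemma mtens_comp l l' l'' m m' m'' (f' : l' ⇒ l'') (f : l ⇒ l')
    (g' : m' ⇒ m'') (g : m ⇒ m') :
  (f' • f) ⊗ (g' • g) = (f' ⊗ g') • (f ⊗ g).
Proof.
  unfold mtens, mcomp. rewrite tensh_comp -!compA.
  now rewrite (compA (splitl _ _) (joinl _ _)) joinlK comp_idl.
Qed.

Lemma mtens_id l m : lid l ⊗ lid m = lid (l ++ m).
Proof. unfold mtens, lid. rewrite tensh_id comp_idr. apply splitlK. Qed.

Lemma joinl_nat l l' m m' (f : l ⇒ l') (g : m ⇒ m') :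
  (f ⊗ g) ∘ joinl l m = joinl l' m' ∘ tensh f g.
Proof. unfold mtens. now rewrite -compA joinlK comp_idr. Qed.

Lemma mtens_assoc l1 l1' l2 l2' l3 l3' (f : l1 ⇒ l1') (g : l2 ⇒ l2')
    (h : l3 ⇒ l3') :
  castl (appA l1' l2' l3') • ((f ⊗ g) ⊗ h)
  = (f ⊗ (g ⊗ h)) • castl (appA l1 l2 l3).
Proof.
  assert (Hi : joinl (l1 ++ l2) l3 ∘ tensh (joinl l1 l2) (idm ⟦l3⟧)
    ∘ (tensh (splitl l1 l2) (idm ⟦l3⟧) ∘ splitl (l1 ++ l2) l3) = idm _).
  { rewrite compA -(compA (joinl _ _)) -tensh_compr splitlK tensh_id.
    rewrite comp_idr. apply splitlK. }
  apply (epi_cancel Hi). unfold mcomp.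
  rewrite -(compA (castl (appA l1' l2' l3')) ((f ⊗ g) ⊗ h)).
  rewrite (compA ((f ⊗ g) ⊗ h)) joinl_nat -(compA (joinl _ _)) -tensh_comp.
  rewrite joinl_nat comp_idr -(compA (f ⊗ (g ⊗ h))) (compA (castl (appA l1 l2 l3))).
  rewrite joinA -{1}(comp_idl h) tensh_comp !(compA (castl _)) (compA (_ ∘ _)) joinA.
  rewrite -(compA (joinl _ _)) !(compA (f ⊗ (g ⊗ h))) joinl_nat.
  rewrite -!(compA (joinl _ _)) -!(compA (tensh _ _)) assoc_nat. f_equal.
  rewrite !compA. f_equal.
  now rewrite -!tensh_comp joinl_nat comp_idl comp_idr.
Qed.

Lemma mtens_lid0 l l' (f : l ⇒ l') :
  castl (app0 l') • (f ⊗ lid []) = f • castl (app0 l).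
Proof.
  apply (epi_cancel (splitlK l [])). unfold mcomp.
  rewrite -(compA (castl _)) -(compA f) joinl_nat join0 compA join0. apply runit_nat.
Qed.

Lemma lid0_mtens l l' (f : l ⇒ l') : lid [] ⊗ f = f.
Proof.
  apply (epi_cancel (splitlK [] l)). rewrite joinl_nat. apply lunit_nat.
Qed.

(** The transported form is preferred to the one with [castl]: on concrete lists it is convertible
    to a plain equation, with no identity factors left over. *)
Lemma castl_rect a a' b b' (e : a = b) (e' : a' = b') (x : a ⇒ a') (y : b ⇒ b') :
  castl e' • x = y • castl e ->
  eq_rect _ (fun c => c ⇒ b') (eq_rect _ (fun c => a ⇒ c) x _ e') _ e = y.
Proof. destruct e, e'. cbn. now rewrite mcomp1f mcompf1. Qed.

(* For lists of known length [appA] and [app0] reduce to [eq_refl], and the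
  following lemmas become equations without transport by conversion. *)

Lemma mtensA l1 l1' l2 l2' l3 l3' (f : l1 ⇒ l1') (g : l2 ⇒ l2')
    (h : l3 ⇒ l3') :
  eq_rect _ (fun a => a ⇒ l1' ++ (l2' ++ l3'))
    (eq_rect _ (fun b => (l1 ++ l2) ++ l3 ⇒ b) ((f ⊗ g) ⊗ h) _ (appA l1' l2' l3'))
    _ (appA l1 l2 l3) = f ⊗ (g ⊗ h).
Proof. apply castl_rect, mtens_assoc. Qed.

Lemma mtens_nil l l' (f : l ⇒ l') :
  eq_rect _ (fun a => a ⇒ l')
    (eq_rect _ (fun b => l ++ [] ⇒ b) (f ⊗ lid []) _ (app0 l')) _ (app0 l) = f.
Proof. apply castl_rect, mtens_lid0. Qed.

(** * Whiskering *)

Definition lw X l m (f : l ⇒ m) : X :: l ⇒ X :: m := mid X ⊗ f.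
Definition rw l m (f : l ⇒ m) p : l ++ p ⇒ m ++ p := f ⊗ lid p.

(** The type is spelled with [X :: p] instead of [[X] ++ p], so that rewriting matches it
    syntactically. *)
Definition rw1 X Y (f : [X] ⇒ [Y]) p : X :: p ⇒ Y :: p := rw f p.

Fixpoint lws q l m (f : l ⇒ m) : q ++ l ⇒ q ++ m :=
  match q with
  | [] => f
  | X :: q' => lw X (lws q' f)
  end.

Local Notation "X ◁ f" := (lw X f) (at level 38, right associativity).
Local Notation "f ▷ p" := (rw f p) (at level 37, left associativity).

Lemma lw_comp X l m n (g : m ⇒ n) (f : l ⇒ m) : X ◁ (g • f) = X ◁ g • X ◁ f.
Proof.
  refine (eq_trans _ (mtens_comp (mid X) (mid X) g f)).
  now rewrite (mcomp1f (mid X) : mid X • mid X = mid X).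
Qed.

Lemma rw_comp l m n (g : m ⇒ n) (f : l ⇒ m) p : (g • f) ▷ p = g ▷ p • f ▷ p.
Proof. unfold rw. now rewrite -mtens_comp mcomp1f. Qed.

Lemma lw_id X l : X ◁ lid l = lid (X :: l).
Proof. apply (mtens_id [X] l). Qed.

Lemma rw_id l p : lid l ▷ p = lid (l ++ p).
Proof. apply mtens_id. Qed.

Lemma lw_rw X l m (f : l ⇒ m) p : (X ◁ f) ▷ p = X ◁ (f ▷ p).
Proof. exact (mtensA (mid X) f (lid p)). Qed.

Lemma lws_mtens q l m (f : l ⇒ m) : lws q f = lid q ⊗ f.
Proof.
  induction q as [|X q IH]; cbn [lws].
  - symmetry. apply lid0_mtens.
  - rewrite IH. unfold lw.
    rewrite -(mtensA (mid X) (lid q) f). cbn.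
    change (mid X) with (lid [X]). now rewrite mtens_id.
Qed.

(** Bifunctoriality of the tensor product; the laws with suffix [_i] below all stem from it. *)
Lemma interchange l m p p' (f : l ⇒ m) (h : p ⇒ p') :
  f ▷ p' • lws l h = lws m h • f ▷ p.
Proof.
  unfold rw. rewrite !lws_mtens -!mtens_comp.
  now rewrite !mcomp1f !mcompf1.
Qed.

Lemma mtens_rw_lws l1 l1' l2 l2' (f : l1 ⇒ l1') (g : l2 ⇒ l2') :
  f ⊗ g = f ▷ l2' • lws l1 g.
Proof. unfold rw. now rewrite lws_mtens -mtens_comp mcomp1f mcompf1. Qed.

Lemma mtens_rw l1 l1' l2 l2' (f : l1 ⇒ l1') (g : l2 ⇒ l2') p :
  eq_rect _ (fun a => a ⇒ l1' ++ (l2' ++ p))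
    (eq_rect _ (fun b => (l1 ++ l2) ++ p ⇒ b) ((f ⊗ g) ▷ p) _ (appA l1' l2' p))
    _ (appA l1 l2 p) = f ▷ (l2' ++ p) • lws l1 (g ▷ p).
Proof. etransitivity; [apply mtensA | apply mtens_rw_lws]. Qed.

Lemma rw_rw l1 l1' (f : l1 ⇒ l1') q p :
  eq_rect _ (fun a => a ⇒ l1' ++ (q ++ p))
    (eq_rect _ (fun b => (l1 ++ q) ++ p ⇒ b) ((f ▷ q) ▷ p) _ (appA l1' q p))
    _ (appA l1 q p) = f ▷ (q ++ p).
Proof. etransitivity; [apply mtensA | now rewrite mtens_id]. Qed.

(** Both maps are identities of M, since [⟦[⟦l⟧]⟧] is [⟦l⟧] by conversion. They change only the
    list, hence where further strands attach; whiskered by [p] they become rebracketings. *)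
Definition box l : l ⇒ [⟦l⟧] := idm ⟦l⟧.
Definition unbox l : [⟦l⟧] ⇒ l := idm ⟦l⟧.
Definition pack l m (f : l ⇒ m) : [⟦l⟧] ⇒ [⟦m⟧] := f.

Lemma boxK l p : unbox l ▷ p • box l ▷ p = lid (l ++ p).
Proof. rewrite -rw_comp -rw_id. f_equal. apply comp_idl. Qed.

Lemma unboxK l p : box l ▷ p • unbox l ▷ p = lid (⟦l⟧ :: p).
Proof. rewrite -rw_comp. refine (eq_trans _ (rw_id [⟦l⟧] p)). f_equal. apply comp_idl. Qed.

Lemma packE l m (f : l ⇒ m) : pack f = box m • f • unbox l.
Proof. unfold mcomp, box, unbox. now rewrite comp_idl comp_idr. Qed.

Lemma pack_rw l m (f : l ⇒ m) p :
  pack f ▷ p = box m ▷ p • f ▷ p • unbox l ▷ p.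
Proof. now rewrite packE !rw_comp. Qed.

Lemma box1 X p : box [X] ▷ p = lid (X :: p).
Proof. apply (mtens_id [X]). Qed.

Lemma unbox1 X p : unbox [X] ▷ p = lid (X :: p).
Proof. apply (mtens_id [X]). Qed.

Lemma box_cons Y Z l p :
  box (Y :: Z :: l) ▷ p = box [Y; ⟦Z :: l⟧] ▷ p • Y ◁ (box (Z :: l) ▷ p).
Proof.
  rewrite -lw_rw.
  refine (eq_trans _ (rw_comp (box [Y; ⟦Z :: l⟧]) (Y ◁ box (Z :: l)) p)).
  f_equal. unfold lw, mtens, mcomp, box, mid. cbn [joinl splitl app tensl].
  now rewrite tensh_id !comp_idl.
Qed.

Lemma unbox_cons Y Z l p :
  unbox (Y :: Z :: l) ▷ p = Y ◁ (unbox (Z :: l) ▷ p) • unbox [Y; ⟦Z :: l⟧] ▷ p.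
Proof.
  rewrite -lw_rw.
  refine (eq_trans _ (rw_comp (Y ◁ unbox (Z :: l)) (unbox [Y; ⟦Z :: l⟧]) p)).
  f_equal. unfold lw, mtens, mcomp, unbox, mid. cbn [joinl splitl app tensl].
  now rewrite tensh_id !comp_idl.
Qed.

(** A nonempty second list makes [⟦⟦l⟧ :: Y :: q⟧] the very tensor product that is the source of
    [joinl]. *)
Lemma joinl_unbox l Y q : joinl l (Y :: q) = pack (unbox l ▷ (Y :: q)).
Proof.
  unfold pack, rw, mtens, unbox, lid. cbn [joinl splitl app tensl].
  now rewrite tensh_id !comp_idr.
Qed.

Lemma splitl_box l Y q : splitl l (Y :: q) = pack (box l ▷ (Y :: q)).
Proof.
  unfold pack, rw, mtens, box, lid. cbn [joinl splitl app tensl].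
  now rewrite tensh_id !comp_idl.
Qed.

End ListCalculus.

Notation "X ◁ f" := (lw X f) (at level 38, right associativity) : moncat_scope.
Notation "f ▷ p" := (rw f p) (at level 37, left associativity) : moncat_scope.

(** * Crossings *)

Section Crossings.
Variable M : braided.
Implicit Types (l m p q : list M) (X Y Z : M).

Definition sw X Y p : X :: Y :: p ⇒ Y :: X :: p := mbr X Y ▷ p.
Definition swi X Y p : Y :: X :: p ⇒ X :: Y :: p := mbri X Y ▷ p.

Lemma swK X Y p : swi X Y p • sw X Y p = lid _.
Proof.
  refine (eq_trans (eq_sym (rw_comp (mbri X Y) (mbr X Y) p)) (eq_trans _ (rw_id [X; Y] p))). f_equal. apply brK.
Qed.

Lemma swiK X Y p : sw X Y p • swi X Y p = lid _.
Proof.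
  refine (eq_trans (eq_sym (rw_comp (mbr X Y) (mbri X Y) p)) (eq_trans _ (rw_id [Y; X] p))). f_equal. apply briK.
Qed.

(** One braiding against the fused list: naturality in an arbitrary [f : l ⇒ m] is then naturality
    of the braiding, while the hexagon resolves the crossing strand by strand. *)
Definition xr X l p : X :: l ++ p ⇒ l ++ X :: p :=
  unbox l ▷ (X :: p) • sw X ⟦l⟧ p • X ◁ (box l ▷ p).

Definition xl l X p : l ++ X :: p ⇒ X :: l ++ p :=
  X ◁ (unbox l ▷ p) • sw ⟦l⟧ X p • box l ▷ (X :: p).

Lemma sw_nat X X' Y Y' (f : [X] ⇒ [X']) (g : [Y] ⇒ [Y']) p :
  sw X' Y' p • (f ▷ (Y' :: p) • X ◁ (g ▷ p)) = g ▷ (X' :: p) • Y ◁ (f ▷ p) • sw X Y p.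
Proof.
  pose proof (mtens_rw f g p : (f ⊗ g) ▷ p = f ▷ (Y' :: p) • X ◁ (g ▷ p)) as H.
  pose proof (mtens_rw g f p : (g ⊗ f) ▷ p = g ▷ (X' :: p) • Y ◁ (f ▷ p)) as H'.
  unfold sw. rewrite -H -H'.
  refine (eq_trans (eq_sym (rw_comp (mbr X' Y') (f ⊗ g) p)) (eq_trans _ (rw_comp (g ⊗ f) (mbr X Y) p))).
  f_equal. unfold mcomp, mtens, mbr. cbn [joinl splitl].
  rewrite !comp_idl !comp_idr. apply br_nat.
Qed.

Lemma sw_natl X X' Y (f : [X] ⇒ [X']) p :
  sw X' Y p • f ▷ (Y :: p) = Y ◁ (f ▷ p) • sw X Y p.
Proof.
  pose proof (sw_nat f (lid [Y]) p) as H.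
  rewrite rw_id rw_id lw_id !mcompf1 in H. cbn [app] in H.
  now rewrite (mcomp1f (Y ◁ (f ▷ p)) : lid (Y :: X' :: p) • _ = _) in H.
Qed.

Lemma sw_natr X Y Y' (g : [Y] ⇒ [Y']) p :
  sw X Y' p • X ◁ (g ▷ p) = g ▷ (X :: p) • sw X Y p.
Proof.
  pose proof (sw_nat (lid [X]) g p) as H.
  rewrite rw_id rw_id lw_id in H. cbn [app] in H.
  now rewrite (mcompf1 (g ▷ (X :: p)) : _ • lid (Y :: X :: p) = _) mcomp1f in H.
Qed.

Lemma xr_nat X l m (f : l ⇒ m) p :
  xr X m p • X ◁ (f ▷ p) = f ▷ (X :: p) • xr X l p.
Proof.
  pose proof (sw_natr X (pack f) p) as H. rewrite !pack_rw !lw_comp in H.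
  apply (f_equal (fun z => unbox m ▷ (X :: p) • z • X ◁ (box l ▷ p))) in H.
  move: H. unfold xr. rewrite !mcompA -(lw_comp X (unbox l ▷ p)).
  rewrite boxK lw_id mcompf1. move=> ->.
  by rewrite -(mcompA (unbox m ▷ _)) boxK mcomp1f.
Qed.

Lemma xl_nat X l m (f : l ⇒ m) p :
  xl m X p • f ▷ (X :: p) = X ◁ (f ▷ p) • xl l X p.
Proof.
  pose proof (sw_natl X (pack f) p) as H. rewrite !pack_rw !lw_comp in H.
  apply (f_equal (fun z => X ◁ (unbox m ▷ p) • z • (box l ▷ (X :: p)))) in H.
  move: H. unfold xl. rewrite !mcompA boxK mcompf1. move=> ->.
  by rewrite -(mcompA (X ◁ _)) -(lw_comp X (unbox m ▷ p)) boxK lw_id mcomp1f.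
Qed.

(** A crossing with the unit object is trivial, by [lunit_br]. *)
Lemma xr_nil X p : xr X [] p = lid (X :: p).
Proof.
  unfold xr, sw.
  rewrite -(lw_rw X (box []) p).
  rewrite -(rw_rw (unbox []) [X] p : (unbox [] ▷ [X]) ▷ p = unbox [] ▷ (X :: p)).
  rewrite -(rw_comp (unbox [] ▷ [X]) (mbr X munit) p).
  rewrite -(rw_comp (unbox [] ▷ [X] • mbr X munit) (X ◁ box []) p).
  rewrite -(rw_id [X] p). f_equal.
  unfold lw, rw, mtens, mcomp, unbox, box, mid, lid, mbr.
  cbn [joinl splitl tensl app].
  by rewrite !tensh_id !comp_idr !comp_idl lunit_br runitiK.
Qed.

Lemma xl_nil X p : xl [] X p = lid (X :: p).
Proof.
  unfold xl, sw.
  rewrite -(lw_rw X (unbox []) p).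
  rewrite -(rw_rw (box []) [X] p : (box [] ▷ [X]) ▷ p = box [] ▷ (X :: p)).
  rewrite -(rw_comp (X ◁ unbox []) (mbr munit X) p).
  rewrite -(rw_comp (X ◁ unbox [] • mbr munit X) (box [] ▷ [X]) p).
  rewrite -(rw_id [X] p). f_equal.
  unfold lw, rw, mtens, mcomp, unbox, box, mid, lid, mbr.
  cbn [joinl splitl tensl app].
  by rewrite !tensh_id !comp_idr !comp_idl runit_br lunitiK.
Qed.

Lemma xr_pair X Y Z p :
  unbox [Y; Z] ▷ (X :: p) • sw X (tens Y Z) p • X ◁ (box [Y; Z] ▷ p)
  = Y ◁ sw X Z p • sw X Y (Z :: p).
Proof.
  unfold sw.
  rewrite -(lw_rw X (box [Y; Z]) p) -(lw_rw Y (mbr X Z) p).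
  rewrite -(rw_rw (unbox [Y; Z]) [X] p
    : (unbox [Y; Z] ▷ [X]) ▷ p = unbox [Y; Z] ▷ (X :: p)).
  rewrite -(rw_rw (mbr X Y) [Z] p : (mbr X Y ▷ [Z]) ▷ p = mbr X Y ▷ (Z :: p)).
  rewrite -(rw_comp (unbox [Y; Z] ▷ [X]) (mbr X (tens Y Z)) p).
  rewrite -(rw_comp (unbox [Y; Z] ▷ [X] • mbr X (tens Y Z)) (X ◁ box [Y; Z]) p).
  rewrite -(rw_comp (Y ◁ mbr X Z) (mbr X Y ▷ [Z]) p). f_equal.
  unfold lw, rw, mtens, mcomp, unbox, box, mid, lid, mbr.
  cbn [joinl splitl tensl app].
  rewrite !tensh_id !comp_idr !comp_idl.
  apply (epi_cancel (associK X Y Z)). rewrite hexagon1.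
  by rewrite -!compA assocK comp_idr.
Qed.

Lemma xl_pair X Y Z p :
  X ◁ (unbox [Y; Z] ▷ p) • sw (tens Y Z) X p • box [Y; Z] ▷ (X :: p)
  = sw Y X (Z :: p) • Y ◁ sw Z X p.
Proof.
  unfold sw.
  rewrite -(lw_rw X (unbox [Y; Z]) p) -(lw_rw Y (mbr Z X) p).
  rewrite -(rw_rw (box [Y; Z]) [X] p
    : (box [Y; Z] ▷ [X]) ▷ p = box [Y; Z] ▷ (X :: p)).
  rewrite -(rw_rw (mbr Y X) [Z] p : (mbr Y X ▷ [Z]) ▷ p = mbr Y X ▷ (Z :: p)).
  rewrite -(rw_comp (X ◁ unbox [Y; Z]) (mbr (tens Y Z) X) p).
  rewrite -(rw_comp (X ◁ unbox [Y; Z] • mbr (tens Y Z) X) (box [Y; Z] ▷ [X]) p).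
  rewrite -(rw_comp (mbr Y X ▷ [Z]) (Y ◁ mbr Z X) p). f_equal.
  unfold lw, rw, mtens, mcomp, unbox, box, mid, lid, mbr.
  cbn [joinl splitl tensl app].
  rewrite !tensh_id !comp_idr !comp_idl.
  apply (mono_cancel (associK X Y Z)). rewrite compA hexagon2.
  by rewrite !compA assocK comp_idl.
Qed.

Lemma xr_cons X Y l p : xr X (Y :: l) p = Y ◁ xr X l p • sw X Y (l ++ p).
Proof.
  destruct l as [|Z l].
  - rewrite xr_nil lw_id mcomp1f. unfold xr.
    by rewrite unbox1 box1 lw_id mcompf1 mcomp1f.
  - pose proof (xr_pair X Y ⟦Z :: l⟧ p) as H.
    unfold xr. rewrite unbox_cons box_cons !lw_comp.
    apply (f_equal (fun z => Y ◁ (unbox (Z :: l) ▷ (X :: p)) • z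
      • X ◁ Y ◁ (box (Z :: l) ▷ p))) in H.
    move: H. rewrite !mcompA. move=> ->. do 2 f_equal.
    exact (interchange (mbr X Y) (box (Z :: l) ▷ p)).
Qed.

Lemma xl_cons X Y l p : xl (Y :: l) X p = sw Y X (l ++ p) • Y ◁ xl l X p.
Proof.
  destruct l as [|Z l].
  - rewrite xl_nil lw_id mcompf1. unfold xl.
    by rewrite unbox1 box1 lw_id mcompf1 mcomp1f.
  - pose proof (xl_pair X Y ⟦Z :: l⟧ p) as H.
    unfold xl. rewrite unbox_cons box_cons !lw_comp.
    apply (f_equal (fun z => X ◁ Y ◁ (unbox (Z :: l) ▷ p) • z
      • Y ◁ (box (Z :: l) ▷ (X :: p)))) in H.
    move: H. rewrite !mcompA. move=> ->. rewrite -!mcompA. do 2 f_equal.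
    exact (eq_sym (interchange (mbr Y X) (unbox (Z :: l) ▷ p))).
Qed.

(** * Inverse crossings *)

Definition xri X l p : l ++ X :: p ⇒ X :: l ++ p :=
  X ◁ (unbox l ▷ p) • swi X ⟦l⟧ p • box l ▷ (X :: p).

Definition xli l X p : X :: l ++ p ⇒ l ++ X :: p :=
  unbox l ▷ (X :: p) • swi ⟦l⟧ X p • X ◁ (box l ▷ p).

Lemma xrK X l p : xri X l p • xr X l p = lid (X :: l ++ p).
Proof.
  unfold xr, xri. rewrite !mcompA -(mcompA (box l ▷ _)) unboxK mcomp1f.
  rewrite -(mcompA (swi X _ _)) swK mcomp1f.
  by rewrite -(lw_comp X (unbox l ▷ p)) boxK lw_id.
Qed.

Lemma xriK X l p : xr X l p • xri X l p = lid (l ++ X :: p).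
Proof.
  unfold xr, xri. rewrite !mcompA -(mcompA (X ◁ (box l ▷ _))).
  rewrite -(lw_comp X (box l ▷ p)) unboxK lw_id mcomp1f.
  by rewrite -(mcompA (sw X _ _)) swiK mcomp1f boxK.
Qed.

Lemma xlK X l p : xli l X p • xl l X p = lid (l ++ X :: p).
Proof.
  unfold xl, xli. rewrite !mcompA -(mcompA (X ◁ (box l ▷ _))).
  rewrite -(lw_comp X (box l ▷ p)) unboxK lw_id mcomp1f.
  by rewrite -(mcompA (swi _ X _)) swK mcomp1f boxK.
Qed.

Lemma xliK X l p : xl l X p • xli l X p = lid (X :: l ++ p).
Proof.
  unfold xl, xli. rewrite !mcompA -(mcompA (box l ▷ _)) unboxK mcomp1f.
  rewrite -(mcompA (sw _ X _)) swiK mcomp1f.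
  by rewrite -(lw_comp X (unbox l ▷ p)) boxK lw_id.
Qed.

Lemma xli_nat X l m (f : l ⇒ m) p :
  xli m X p • X ◁ (f ▷ p) = f ▷ (X :: p) • xli l X p.
Proof.
  rewrite -{1}(mcompf1 (X ◁ (f ▷ p))) -(xliK X l p).
  by rewrite -(mcompA (X ◁ _)) -xl_nat mcompA -(mcompA (xli _ _ _)) xlK mcomp1f.
Qed.

Lemma mcomp_inverse_unique l m (a : m ⇒ l) (b : l ⇒ m) (c : m ⇒ l) :
  a • b = lid l -> b • c = lid m -> a = c.
Proof. intros H1 H2. by rewrite -(mcompf1 a) -H2 -mcompA H1 mcomp1f. Qed.

(** Inverses are unique, so the decomposition is inherited from [xr_cons] without another use of the
    hexagon. *)
Lemma xri_cons X Y l p : xri X (Y :: l) p = swi X Y (l ++ p) • Y ◁ xri X l p.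
Proof.
  apply (mcomp_inverse_unique (xrK X (Y :: l) p)).
  rewrite xr_cons !mcompA -(mcompA (sw X Y _)) swiK mcomp1f.
  by rewrite -lw_comp xriK lw_id.
Qed.

Lemma xli_cons X Y l p : xli (Y :: l) X p = Y ◁ xli l X p • swi Y X (l ++ p).
Proof.
  apply (mcomp_inverse_unique (xlK X (Y :: l) p)).
  rewrite xl_cons !mcompA -(mcompA (Y ◁ xl _ _ _)).
  rewrite -lw_comp xliK lw_id mcomp1f. apply swiK.
Qed.

Lemma xri_nil X p : xri X [] p = lid (X :: p).
Proof. apply (mcomp_inverse_unique (xrK X [] p)). by rewrite xr_nil mcomp1f. Qed.

Lemma xli_nil X p : xli [] X p = lid (X :: p).
Proof. apply (mcomp_inverse_unique (xlK X [] p)). by rewrite xl_nil mcomp1f. Qed.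

End Crossings.

Unset SsrRewrite.

(** * Weak bimonoids *)

Section Rewriting.
Variable M : monoidal.
Implicit Types l m n o : list M.

Lemma mcomp_eq2 l m n (a : m ⇒ n) (b : l ⇒ m) (c : l ⇒ n) o (k : o ⇒ l) :
  a • b = c -> a • (b • k) = c • k.
Proof. intros H. now rewrite <- mcompA, H. Qed.

Lemma mcomp_eq3 l m n n' (a : n ⇒ n') (b : m ⇒ n) (c : l ⇒ m) (d : l ⇒ n')
    o (k : o ⇒ l) :
  a • (b • c) = d -> a • (b • (c • k)) = d • k.
Proof. intros H. now rewrite <- H, !mcompA. Qed.

Lemma mcomp_eq4 l m n n' n'' (a : n' ⇒ n'') (b : n ⇒ n') (c : m ⇒ n) (d : l ⇒ m)
    (e : l ⇒ n'') o (k : o ⇒ l) :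
  a • (b • (c • d)) = e -> a • (b • (c • (d • k))) = e • k.
Proof. intros H. now rewrite <- H, !mcompA. Qed.

Lemma lw_eq2 (X : M) l m n (a : m ⇒ n) (b : l ⇒ m) (c : l ⇒ n) :
  a • b = c -> X ◁ a • X ◁ b = X ◁ c.
Proof. intros H. now rewrite <- lw_comp, H. Qed.

Lemma lw_eq3 (X : M) l m n n' (a : n ⇒ n') (b : m ⇒ n) (c : l ⇒ m) (d : l ⇒ n') :
  a • (b • c) = d -> X ◁ a • (X ◁ b • X ◁ c) = X ◁ d.
Proof. intros H. now rewrite <- !lw_comp, H. Qed.
End Rewriting.

(* Composites are kept nested to the right, so the equation is also tried with a tail behind its two
   or three factors. *)
Tactic Notation "layer" uconstr(H) :=
  first [rewrite H | rewrite (mcomp_eq2 _ H) | rewrite (mcomp_eq3 _ H)];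
  rewrite ?lw_comp, ?mcompA.

Ltac mtens_simpl_in H :=
  rewrite ?rw_comp in H; cbn [app] in H;
  repeat match type of H with
  | context [@rw _ _ _ (@mtens _ _ _ _ _ ?f ?g) ?p] =>
    let E := fresh "E" in
    pose proof (mtens_rw f g p) as E;
    cbn [eq_rect appA app f_equal lws] in E; rewrite E in H; clear E
  end.

Lemma mid_rw (M : monoidal) (X : M) p : mid X ▷ p = lid (X :: p).
Proof. exact (rw_id [X] p). Qed.

(** Whiskers an equation by [p] and flattens its tensor products into layers. *)
Ltac strict_in H p :=
  apply (f_equal (fun f => f ▷ p)) in H; cbn beta in H;
  mtens_simpl_in H; rewrite ?mid_rw, ?lw_id, ?mcompA in H; cbn [app] in H;
  rewrite ?mcomp1f, ?mcompf1 in H.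

(** Specialises a naturality law to a generator and resolves the crossings with its source and
    target into elementary ones. *)
Ltac crossing H :=
  let E := fresh "E" in pose proof H as E;
  rewrite ?xr_cons, ?xr_nil, ?xl_cons, ?xl_nil, ?xri_cons, ?xri_nil,
    ?xli_cons, ?xli_nil, ?lw_id in E; cbn [app] in E;
  rewrite ?lw_id, ?mcompf1, ?mcomp1f in E; exact E.

Section WeakBimonoid.
Variables (M : braided) (D : bimonoid_data M).
Implicit Types (p q : list M) (X Y : M).
Local Notation B := (bm_obj D).

Definition mu p : B :: B :: p ⇒ B :: p := bm_mul D ▷ p.
Definition eta p : p ⇒ B :: p := bm_unit D ▷ p.
Definition de p : B :: p ⇒ B :: B :: p := bm_comul D ▷ p.
Definition ep p : B :: p ⇒ p := bm_counit D ▷ p.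
(** [uu] is 1_1 ⊗ 1_2 and [ev] is the pairing ε(b b'). In a weak bimonoid they need not split into
    two units or two counits, so they serve as generators of their own. *)
Definition uu p : p ⇒ B :: B :: p := (bm_comul D • bm_unit D) ▷ p.
Definition ev p : B :: B :: p ⇒ p := (bm_counit D • bm_mul D) ▷ p.
Definition rwB (f : [B] ⇒ [B]) p : B :: p ⇒ B :: p := f ▷ p.

Lemma uuE p : uu p = de p • eta p.
Proof. exact (rw_comp (bm_comul D) (bm_unit D) p). Qed.

Lemma evE p : ev p = ep p • mu p.
Proof. exact (rw_comp (bm_counit D) (bm_mul D) p). Qed.

(** * Sliding generators past other layers and past crossings *)

Section Interchange.
Variables (p p' : list M) (h : p ⇒ p').
Lemma mu_i : mu p' • B ◁ B ◁ h = B ◁ h • mu p.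
Proof. exact (interchange (bm_mul D) h). Qed.
Lemma eta_i : eta p' • h = B ◁ h • eta p.
Proof. exact (interchange (bm_unit D) h). Qed.
Lemma de_i : de p' • B ◁ h = B ◁ B ◁ h • de p.
Proof. exact (interchange (bm_comul D) h). Qed.
Lemma uu_i : uu p' • h = B ◁ B ◁ h • uu p.
Proof. exact (interchange (bm_comul D • bm_unit D) h). Qed.
Lemma ev_i : ev p' • B ◁ B ◁ h = h • ev p.
Proof. exact (interchange (bm_counit D • bm_mul D) h). Qed.
Lemma fw_i (f : [B] ⇒ [B]) : rwB f p' • B ◁ h = B ◁ h • rwB f p.
Proof. exact (interchange f h). Qed.
Lemma sw_i X Y : sw X Y p' • X ◁ Y ◁ h = Y ◁ X ◁ h • sw X Y p.
Proof. exact (interchange (mbr X Y) h). Qed.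
End Interchange.

Section CrossingLaws.
Variables (X : M) (p : list M).
Lemma sw_mu : sw X B p • X ◁ mu p = mu (X :: p) • (B ◁ sw X B p • sw X B (B :: p)).
Proof. crossing (xr_nat X (bm_mul D) p). Qed.
Lemma mu_sw : sw B X p • mu (X :: p) = X ◁ mu p • (sw B X (B :: p) • B ◁ sw B X p).
Proof. crossing (xl_nat X (bm_mul D) p). Qed.
Lemma eta_sw : sw B X p • eta (X :: p) = X ◁ eta p.
Proof. crossing (xl_nat X (bm_unit D) p). Qed.
Lemma sw_de : B ◁ sw X B p • (sw X B (B :: p) • X ◁ de p) = de (X :: p) • sw X B p.
Proof. rewrite <- mcompA. crossing (xr_nat X (bm_comul D) p). Qed.
Lemma de_sw : sw B X (B :: p) • (B ◁ sw B X p • de (X :: p)) = X ◁ de p • sw B X p.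
Proof. rewrite <- mcompA. crossing (xl_nat X (bm_comul D) p). Qed.
Lemma sw_uu : B ◁ sw X B p • (sw X B (B :: p) • X ◁ uu p) = uu (X :: p).
Proof. rewrite <- mcompA. crossing (xr_nat X (bm_comul D • bm_unit D) p). Qed.
Lemma sw_ev : X ◁ ev p = ev (X :: p) • (B ◁ sw X B p • sw X B (B :: p)).
Proof. crossing (xr_nat X (bm_counit D • bm_mul D) p). Qed.
Lemma swi_ev : X ◁ ev p = ev (X :: p) • (B ◁ swi B X p • swi B X (B :: p)).
Proof. crossing (xli_nat X (bm_counit D • bm_mul D) p). Qed.
Lemma fw_sw f : sw B X p • rwB f (X :: p) = X ◁ rwB f p • sw B X p.
Proof. crossing (xl_nat X f p). Qed.
Lemma sw_sw Y Z : Z ◁ sw X Y p • (sw X Z (Y :: p) • X ◁ sw Y Z p)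
  = sw Y Z (X :: p) • (Y ◁ sw X Z p • sw X Y (Z :: p)).
Proof. rewrite <- mcompA. crossing (xr_nat X (mbr Y Z) p). Qed.
Lemma sw_swi Y Z : Y ◁ sw X Z p • (sw X Y (Z :: p) • X ◁ swi Y Z p)
  = swi Y Z (X :: p) • (Z ◁ sw X Y p • sw X Z (Y :: p)).
Proof. rewrite <- mcompA. crossing (xr_nat X (mbri Y Z) p). Qed.
End CrossingLaws.

Hypothesis W : is_weak_bimonoid D.

(** * The axioms in layers *)

Lemma muA p : mu p • mu (B :: p) = mu p • B ◁ mu p.
Proof. pose proof (wb_mulA W) as H. strict_in H p. exact H. Qed.

Lemma mu1l p : mu p • eta (B :: p) = lid (B :: p).
Proof. pose proof (wb_mul1l W) as H. strict_in H p. exact H. Qed.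

Lemma mu1r p : mu p • B ◁ eta p = lid (B :: p).
Proof. pose proof (wb_mul1r W) as H. strict_in H p. exact H. Qed.

Lemma deA p : de (B :: p) • de p = B ◁ de p • de p.
Proof. pose proof (wb_comulA W) as H. strict_in H p. exact H. Qed.

Lemma de1l p : ep (B :: p) • de p = lid (B :: p).
Proof. pose proof (wb_comul1l W) as H. strict_in H p. exact H. Qed.

Lemma de1r p : B ◁ ep p • de p = lid (B :: p).
Proof. pose proof (wb_comul1r W) as H. strict_in H p. exact H. Qed.

Lemma de_mu p : de p • mu p = mu (B :: p) • (B ◁ B ◁ mu p • (B ◁ sw B B (B :: p)
    • (de (B :: B :: p) • B ◁ de p))).
Proof. pose proof (wb_b W) as H. strict_in H p. exact H. Qed.

Lemma ev_mu p : ev p • mu (B :: p) = ev p • (ev (B :: B :: p) • B ◁ de (B :: p)).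
Proof.
  pose proof (wb_v1 W) as H. strict_in H p.
  rewrite (mcomp_eq2 _ (eq_sym (ev_i (ev p)))), !evE, !lw_comp, !mcompA, (mcomp_eq2 _ (mu_i (ep p))).
  rewrite !mcompA. exact H.
Qed.

Lemma ev_mu_inv p :
  ev p • mu (B :: p) = ev p • (ev (B :: B :: p) • (B ◁ swi B B (B :: p) • B ◁ de (B :: p))).
Proof.
  pose proof (wb_v2 W) as H. strict_in H p.
  rewrite rw_comp, lw_comp in H.
  rewrite (mcomp_eq2 _ (eq_sym (ev_i (ev p)))), !evE, !lw_comp, !mcompA, (mcomp_eq2 _ (mu_i (ep p))).
  rewrite !mcompA. exact H.
Qed.

Lemma de_uu p : B ◁ de p • uu p = B ◁ mu (B :: p) • (uu (B :: B :: p) • uu p).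
Proof.
  pose proof (wb_w1 W) as H. strict_in H p.
  rewrite !uuE, !mcompA, (mcomp_eq2 _ (eta_i _)), !mcompA.
  rewrite (mcomp_eq2 _ (eq_sym (deA _))), !mcompA. exact H.
Qed.

Lemma de_uu_inv p :
  B ◁ de p • uu p = B ◁ mu (B :: p) • (B ◁ swi B B (B :: p) • (uu (B :: B :: p) • uu p)).
Proof.
  pose proof (wb_w2 W) as H. strict_in H p.
  rewrite rw_comp, lw_comp, !mcompA in H.
  rewrite !uuE, !mcompA, (mcomp_eq2 _ (eta_i _)), !mcompA.
  rewrite (mcomp_eq2 _ (eq_sym (deA _))), !mcompA. exact H.
Qed.

(** * The morphisms t and r *)

Lemma t_layers p : rwB (wb_t D) p = B ◁ ev p • (sw B B (B :: p) • B ◁ uu p).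
Proof.
  pose proof (eq_refl (wb_t D)) as H. unfold wb_t at 2 in H. strict_in H p.
  etransitivity; [exact H |].
  now rewrite evE, uuE, !lw_comp, !mcompA.
Qed.

Lemma r_layers p : rwB (wb_r D) p = ev (B :: p) • (B ◁ sw B B p • uu (B :: p)).
Proof.
  pose proof (eq_refl (wb_r D)) as H. unfold wb_r at 2 in H. strict_in H p.
  etransitivity; [exact H |].
  now rewrite evE, uuE, !mcompA.
Qed.

(** Expand ε(b 1 b') by the second half of (v); its inverse crossing cancels the crossing in t. *)
Lemma ev_t p : ev p • rwB (wb_t D) (B :: p) = ev p.
Proof.
  transitivity (ev p • (mu (B :: p) • B ◁ eta (B :: p))).
  - layer (ev_mu_inv _). rewrite t_layers, swi_ev, !mcompA.
    layer (swK B B (B :: B :: p)). rewrite mcomp1f.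
    now rewrite uuE, lw_comp.
  - now rewrite mu1r, mcompf1.
Qed.

Lemma ep_ev p : ep p = ev p • B ◁ eta p.
Proof. now rewrite evE, mcompA, mu1r, mcompf1. Qed.

Lemma ep_t p : ep p • rwB (wb_t D) p = ep p.
Proof.
  rewrite ep_ev, mcompA, <- fw_i. layer (ev_t p). reflexivity.
Qed.

(** Since t(b) = 1_1 ε(b 1_2) depends on b only through the pairing, [ev_t] shows that replacing b
    by t(b) changes nothing. *)
Lemma t_idem p : rwB (wb_t D) p • rwB (wb_t D) p = rwB (wb_t D) p.
Proof.
  rewrite (t_layers p) at 1. rewrite !mcompA, <- fw_i.
  layer (fw_sw _ _ _). layer (lw_eq2 B (ev_t _)). symmetry. apply t_layers.
Qed.

Lemma ev_eta p : ev p • eta (B :: p) = ep p.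
Proof. now rewrite evE, mcompA, mu1l, mcompf1. Qed.

Lemma ep_uu p : B ◁ ep p • uu p = eta p.
Proof. rewrite uuE. layer (de1r p). apply mcomp1f. Qed.

Lemma t_eta p : rwB (wb_t D) p • eta p = eta p.
Proof.
  rewrite t_layers, !mcompA, <- eta_i. layer (eta_sw _ _).
  layer (lw_eq2 B (ev_eta _)). apply ep_uu.
Qed.

(** By (w), the product 1_2 1'_1 is the middle factor of the iterated coproduct of 1, which ε
    removes. *)
Lemma uu_ev_uu p : B ◁ ev (B :: p) • (uu (B :: B :: p) • uu p) = uu p.
Proof.
  rewrite evE, lw_comp, !mcompA, <- de_uu. layer (lw_eq2 B (de1l _)).
  now rewrite lw_id, mcomp1f.
Qed.

(** Apply (b) to b 1: this supplies the second copy of δη in the common value used for [t_de]. *)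
Lemma de_mu_eta p :
  de p = mu (B :: p) • (B ◁ B ◁ mu p • (B ◁ sw B B (B :: p)
    • (B ◁ B ◁ uu p • de p))).
Proof.
  rewrite <- (mcompf1 (de p)) at 1. rewrite <- mu1r. layer (de_mu p).
  rewrite <- de_i, uuE. now rewrite ?lw_comp, ?mcompA.
Qed.

Lemma ev_assoc p : ev p • mu (B :: p) = ev p • B ◁ mu p.
Proof. now rewrite evE, !mcompA, muA. Qed.

Lemma mu_split p :
  mu p = ev (B :: p) • (B ◁ B ◁ mu p • (B ◁ sw B B (B :: p)
    • (de (B :: B :: p) • B ◁ de p))).
Proof.
  rewrite <- (mcomp1f (mu p)), <- de1l at 1. rewrite mcompA, de_mu, evE.
  now rewrite !mcompA.
Qed.

(* In Sweedler notation [t(b_1) ⊗ b_2 = 1_1 ⊗ b 1_2]; both sides equal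
  [1_1 ⊗ ε(b_1 1'_1 1_2) b_2 1'_2]. *)
Lemma t_de p : rwB (wb_t D) (B :: p) • de p = B ◁ mu p • (sw B B (B :: p) • B ◁ uu p).
Proof.
  transitivity (B ◁ ev (B :: p) • (B ◁ B ◁ B ◁ mu p • (B ◁ B ◁ mu (B :: B :: p)
    • (B ◁ B ◁ swi B B (B :: B :: p) • (sw B B (B :: B :: B :: B :: p)
    • (B ◁ uu (B :: B :: B :: p) • (B ◁ sw B B (B :: p) • (B ◁ B ◁ uu p • de p)))))))).
  - rewrite de_mu_eta at 1. rewrite t_layers, !mcompA.
    layer (eq_sym (mu_i (uu (B :: p)))).
    layer (mu_sw _ _).
    layer (lw_eq2 B (lw_eq2 B (uu_i (mu p)))).
    layer (lw_eq2 B (sw_i (B ◁ mu p) _ _)).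
    layer (sw_i (B ◁ B ◁ mu p) _ _).
    layer (lw_eq2 B (mu_i (B ◁ mu p))).
    (* This acts on the common value: drawing its copy of δη across a strand creates the crossing
       that cancels [swi]. *)
    layer (eq_sym (sw_uu B (B :: B :: p))).
    layer (sw_i (sw B B (B :: B :: p)) B B).
    layer (lw_eq2 B (lw_eq2 B (swK B B _))). rewrite !lw_id, mcomp1f.
    layer (lw_eq2 B (ev_i (mu p))). layer (lw_eq2 B (ev_i (mu p))).
    layer (lw_eq2 B (ev_assoc _)). reflexivity.
  - symmetry. rewrite mu_split at 1. rewrite !lw_comp, !mcompA.
    layer (eq_sym (sw_i (de p) B B)).
    layer (eq_sym (de_sw _ _)).
    (* The second half of (w) yields the second copy of δη together with the inverse crossing of the
       common value. *)
    layer (lw_eq2 B (de_uu_inv p)).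
    layer (de_i (B ◁ mu (B :: p))).
    layer (de_i (B ◁ swi B B (B :: p))).
    layer (de_i (uu (B :: B :: p))).
    layer (de_i (uu p)).
    layer (lw_eq2 B (sw_i (mu (B :: p)) B B)).
    layer (sw_i (B ◁ mu (B :: p)) B B).
    layer (lw_eq2 B (lw_eq2 B (sw_mu B (B :: p)))).
    layer (lw_eq2 B (sw_i (swi B B (B :: p)) B B)).
    layer (sw_i (B ◁ swi B B (B :: p)) B B).
    layer (lw_eq3 B (lw_eq3 B (sw_swi B (B :: p) B B))).
    layer (eq_sym (sw_i (sw B B (B :: B :: p)) B B)).
    layer (eq_sym (sw_i (B ◁ sw B B (B :: p)) B B)).
    layer (lw_eq3 B (sw_uu B (B :: B :: p))).
    layer (lw_eq2 B (eq_sym (uu_i (sw B B (B :: p))))).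
    reflexivity.
Qed.

(* In Sweedler notation [r(b_1) ⊗ b_2 = r(1_1) ⊗ 1_2 b]. *)
Lemma r_de p :
  rwB (wb_r D) (B :: p) • de p = B ◁ mu p • (rwB (wb_r D) (B :: B :: p) • uu (B :: p)).
Proof.
  (* The common value is r(1_1) ⊗ ε(1_2 b_1) 1_3 b_2. *)
  transitivity (rwB (wb_r D) (B :: p) • (B ◁ ev (B :: p) • (B ◁ B ◁ B ◁ mu p
    • (B ◁ B ◁ sw B B (B :: p) • (B ◁ de (B :: B :: p) • (B ◁ B ◁ de p
    • uu (B :: p))))))).
  - rewrite <- (mcompf1 (de p)) at 1. rewrite <- mu1l. layer (de_mu p).
    layer (eq_sym (eta_i (de p))). rewrite (r_layers (B :: p)) at 1. rewrite !mcompA.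
    layer (uu_i (mu (B :: p))).
    layer (lw_eq2 B (sw_mu B (B :: p))).
    layer (eq_sym (ev_assoc _)).
    (* With r(b) = ε(1_1 b) 1_2, this splits ε(1'_1 1_1 b_1) into ε(1'_1 1_1) ε(1_2 b_1), so that r
       meets a leg of 1 alone. *)
    layer (ev_mu _).
    layer (lw_eq2 B (de_i (sw B B (B :: p)))).
    layer (lw_eq2 B (eq_sym (sw_de B (B :: B :: p)))).
    layer (ev_i (B ◁ sw B B (B :: p))).
    layer (ev_i (sw B B (B :: B :: p))).
    layer (eq_sym (sw_ev _ _)).
    layer (eq_sym (uu_i (de (B :: B :: p)))).
    layer (eq_sym (r_layers _)).
    layer (eq_sym (fw_i (ev (B :: p)) _)).
    layer (de_i (B ◁ mu p)).
    layer (de_i (sw B B (B :: p))).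
    layer (deA _).
    rewrite (mcomp_eq2 _ (eq_sym (uuE _))), <- uu_i.
    reflexivity.
  - symmetry. layer (eq_sym (fw_i (mu p) _)). rewrite (mu_split p) at 1.
    now rewrite !lw_comp, !mcompA.
Qed.

End WeakBimonoid.

(** * The morphisms Φ_f *)

Section Galois.
Variables (M : braided) (D : bimonoid_data M).
Hypothesis W : is_weak_bimonoid D.
Implicit Types (p q : list M) (X Y : M) (f g : [bm_obj D] ⇒ [bm_obj D]).
Local Notation B := (bm_obj D).
Local Notation mu := (mu D).
Local Notation eta := (eta D).
Local Notation de := (de D).
Local Notation ep := (ep D).
Local Notation uu := (uu D).
Local Notation ev := (ev D).
Local Notation t := (wb_t D).
Local Notation r := (wb_r D).

(* [b ⊗ b' ↦ b f(b'_1) ⊗ b'_2]. *)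
Definition galois f p : B :: B :: p ⇒ B :: B :: p :=
  mu (B :: p) • (B ◁ rwB f (B :: p) • B ◁ de p).

Lemma convolution_layers f g p :
  rwB (convolution (D := D) f g) p = mu p • (rwB f (B :: p) • (B ◁ rwB g p • de p)).
Proof.
  pose proof (eq_refl (convolution (D := D) f g)) as H.
  unfold convolution at 2 in H. strict_in H p. exact H.
Qed.

Lemma galois_comp f g p :
  galois f p • galois g p = galois (convolution (D := D) g f) p.
Proof.
  unfold galois. rewrite convolution_layers, ?lw_comp, ?mcompA.
  layer (eq_sym (mu_i D (de p))).
  layer (eq_sym (mu_i D (rwB f (B :: p)))).
  layer (muA W (B :: p)).
  layer (lw_eq2 B (eq_sym (fw_i (de p) g))).
  layer (lw_eq2 B (eq_sym (deA W p))).
  layer (lw_eq2 B (eq_sym (fw_i (rwB f (B :: p)) g))).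
  reflexivity.
Qed.

Lemma galois_fw_inj f g : (forall p, galois f p = galois g p) -> f = g.
Proof.
  intros H.
  assert (G : forall h, B ◁ ep [] • (galois h [] • eta [B]) = rwB h []).
  { intros h. unfold galois. rewrite !mcompA.
    layer (eq_sym (mu_i D (ep []))).
    layer (lw_eq2 B (eq_sym (fw_i (ep []) h))).
    layer (lw_eq2 B (de1r W [])). rewrite lw_id, mcomp1f.
    layer (eq_sym (eta_i D (rwB h []))). layer (mu1l W []). apply mcomp1f. }
  pose proof (mtens_nil f) as Hf. pose proof (mtens_nil g) as Hg.
  cbn in Hf, Hg.
  rewrite <- Hf, <- Hg.
  change (rwB f [] = rwB g []). now rewrite <- !G, H.
Qed.

Lemma galois_t p :
  galois t p = mu (B :: p) • (B ◁ B ◁ mu p • (B ◁ sw B B (B :: p) • B ◁ B ◁ uu p)).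
Proof. unfold galois. layer (lw_eq2 B (t_de W p)). reflexivity. Qed.

Lemma galois_r p :
  galois r p = mu (B :: p) • (B ◁ B ◁ mu p • (B ◁ rwB r (B :: B :: p) • B ◁ uu (B :: p))).
Proof. unfold galois. layer (lw_eq2 B (r_de W p)). reflexivity. Qed.

(** Carrying the second B across Y and back by the inverse crossing keeps the order B, Y, B in which
    the strands occur in TX ⊗ TY. *)
Definition ygalois f Y p : B :: Y :: B :: p ⇒ B :: Y :: B :: p :=
  B ◁ swi Y B p • (galois f (Y :: p) • B ◁ sw Y B p).

Lemma ygaloisP f Y p (h : B :: Y :: B :: p ⇒ B :: Y :: B :: p) :
  B ◁ sw Y B p • h = galois f (Y :: p) • B ◁ sw Y B p -> h = ygalois f Y p.
Proof.
  intros H. unfold ygalois. rewrite <- H.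
  layer (lw_eq2 B (swK Y B p)). now rewrite lw_id, mcomp1f.
Qed.

Lemma ygalois_comp f g Y p :
  ygalois f Y p • ygalois g Y p = ygalois (convolution (D := D) g f) Y p.
Proof.
  unfold ygalois. rewrite !mcompA. layer (lw_eq2 B (swiK Y B p)).
  rewrite lw_id, mcomp1f. layer (galois_comp f g _). reflexivity.
Qed.

(** The left sides here, in [ygalois_t] and in [ygalois_r] are what remains of can, E and F once the
    objects TX are opened into strands and X is set aside. *)
Lemma ygalois_id Y p :
  mu (Y :: B :: p) • (B ◁ sw Y B (B :: p) • B ◁ Y ◁ de p) = ygalois (mid B) Y p.
Proof.
  apply ygaloisP. layer (eq_sym (mu_i D (sw Y B p))).
  layer (lw_eq3 B (sw_de D Y p)). unfold galois.
  change (rwB (mid B) (B :: Y :: p)) with (mid B ▷ (B :: Y :: p)).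
  now rewrite mid_rw, lw_id, mcomp1f, mcompA.
Qed.

Lemma ygalois_t Y p :
  mu (Y :: B :: p) • (B ◁ B ◁ Y ◁ mu p • (B ◁ sw Y B (B :: B :: p)
    • (B ◁ Y ◁ sw B B (B :: p) • B ◁ Y ◁ B ◁ uu p))) = ygalois t Y p.
Proof.
  apply ygaloisP. rewrite galois_t, !mcompA.
  layer (eq_sym (mu_i D (sw Y B p))).
  layer (lw_eq2 B (lw_eq2 B (sw_mu D Y p))).
  layer (lw_eq3 B (sw_sw Y (B :: p) B B)).
  rewrite <- (sw_uu D Y p), ?lw_comp, ?mcompA.
  layer (lw_eq2 B (eq_sym (sw_i (uu p) Y B))).
  layer (lw_eq2 B (sw_i (sw Y B p) B B)). reflexivity.
Qed.

Lemma ygalois_r Y p :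
  mu (Y :: B :: p) • (B ◁ B ◁ Y ◁ mu p • (B ◁ rwB r (Y :: B :: B :: p)
    • (B ◁ sw Y B (B :: B :: p) • B ◁ Y ◁ uu (B :: p)))) = ygalois r Y p.
Proof.
  apply ygaloisP. rewrite galois_r, !mcompA.
  layer (eq_sym (mu_i D (sw Y B p))).
  layer (lw_eq2 B (lw_eq2 B (sw_mu D Y p))).
  layer (lw_eq2 B (uu_i D (sw Y B p))).
  rewrite <- (sw_uu D Y (B :: p)), ?lw_comp, ?mcompA.
  layer (lw_eq2 B (eq_sym (fw_i (sw Y B (B :: p)) r))).
  layer (lw_eq2 B (eq_sym (fw_i (B ◁ sw Y B p) r))). reflexivity.
Qed.

Lemma ygalois_nat f Y Y' (g : [Y] ⇒ [Y']) p :
  B ◁ rw1 g (B :: p) • ygalois f Y p = ygalois f Y' p • B ◁ rw1 g (B :: p).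
Proof.
  assert (H1 : swi Y' B p • B ◁ rw1 g p = rw1 g (B :: p) • swi Y B p)
    by crossing (xli_nat B g p).
  assert (H2 : sw Y' B p • rw1 g (B :: p) = B ◁ rw1 g p • sw Y B p)
    by crossing (xl_nat B g p).
  unfold ygalois, galois. rewrite !mcompA.
  layer (lw_eq2 B H2). layer (lw_eq2 B (de_i D (rw1 g p))). layer (lw_eq2 B (fw_i (B ◁ rw1 g p) f)).
  layer (mu_i D (B ◁ rw1 g p)). layer (lw_eq2 B H1). reflexivity.
Qed.

Definition rw2 (h : [B; B] ⇒ [B; B]) p : B :: B :: p ⇒ B :: B :: p := h ▷ p.

(* A left linear and right colinear [h] is determined by [(B ⊗ ε) h (η ⊗ B)]. *)
Lemma linear_colinear_galois (h : [B; B] ⇒ [B; B]) :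
  (forall p, rw2 h p • mu (B :: p) = mu (B :: p) • B ◁ rw2 h p) ->
  (forall p, rw2 h (B :: p) • B ◁ de p = B ◁ de p • rw2 h p) ->
  exists f, forall p, rw2 h p = galois f p.
Proof.
  intros Hl Hc.
  set (f := (mid B ⊗ bm_counit D) • h • (bm_unit D ⊗ mid B)).
  assert (E : forall p, rwB f p = B ◁ ep p • (rw2 h p • eta (B :: p))).
  { intros p. pose proof (eq_refl f) as H. unfold f at 2 in H.
    strict_in H p. exact H. }
  exists f. intros p. unfold galois. rewrite E, !lw_comp, !mcompA.
  (* Left linearity brings b under [h], where it is multiplied by the unit; right colinearity moves
     δ past [h], where ε cancels it. *)
  layer (mu_i D (ep (B :: p))).
  layer (eq_sym (Hl (B :: p))).
  layer (mu1r W _). rewrite mcomp1f.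
  layer (Hc _). layer (lw_eq2 B (de1l W _)). now rewrite lw_id, mcomp1f.
Qed.

Lemma galois_mu f p :
  galois f p • mu (B :: p) = mu (B :: p) • B ◁ galois f p.
Proof.
  unfold galois. rewrite !lw_comp, !mcompA.
  layer (eq_sym (mu_i D (de p))). layer (eq_sym (mu_i D (rwB f (B :: p)))).
  layer (muA W _). reflexivity.
Qed.

Lemma galois_de f p :
  galois f (B :: p) • B ◁ de p = B ◁ de p • galois f p.
Proof.
  unfold galois. rewrite ?mcompA.
  layer (lw_eq2 B (deA W p)). layer (lw_eq2 B (fw_i (de p) f)). layer (mu_i D (de p)). reflexivity.
Qed.

(* [h] is left linear and right colinear because morphisms into the image of
  [galois r] may be compared after composition with [galois (mid B)]. *)
Lemma antipode_of_galois_inverse (h : [B; B] ⇒ [B; B]) :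
  (forall p, rw2 h p • galois t p = rw2 h p) ->
  (forall p, galois r p • rw2 h p = rw2 h p) ->
  (forall p, rw2 h p • galois (mid B) p = galois r p) ->
  (forall p, galois (mid B) p • rw2 h p = galois t p) ->
  exists f, is_antipode f.
Proof.
  intros Ht Hr H1 H2.
  assert (Hu : forall p q (a a' : q ⇒ B :: B :: p), galois r p • a = a ->
    galois r p • a' = a' -> galois (mid B) p • a = galois (mid B) p • a' -> a = a').
  { intros p q a a' Ha Ha' E. now rewrite <- Ha, <- Ha', <- H1, !mcompA, E. }
  destruct (@linear_colinear_galois h) as [f Hf].
  - intros p. apply Hu.
    + now rewrite <- mcompA, Hr.
    + layer (galois_mu _ _). now rewrite (lw_eq2 B (Hr _)).
    + layer (H2 _). layer (galois_mu (mid B) _). now rewrite (lw_eq2 B (H2 _)), galois_mu.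
  - intros p. apply Hu.
    + now rewrite <- mcompA, Hr.
    + layer (galois_de _ _). now layer (Hr _).
    + layer (H2 _). layer (galois_de (mid B) _). now rewrite H2, galois_de.
  - exists f. repeat split; apply galois_fw_inj; intros p;
      rewrite <- ?galois_comp, <- ?Hf.
    + apply H2.
    + apply H1.
    + now rewrite H2, Ht.
Qed.
End Galois.

(** * The weak bimonad of a weak bimonoid *)

Ltac rewrite_cbn E :=
  let H := fresh in pose proof E as H;
  cbn [app eq_rect appA f_equal lws] in H; cbn [app]; rewrite H; clear H.

(** Hides the right side behind a variable, so that the flattening affects the left side alone. *)
Ltac strict_lhs :=
  let x := fresh "x" in let H := fresh "H" in
  match goal with |- ?a = ?b => enough (H : forall x, a = x -> x = b) by auto end;
  intros x H; mtens_simpl_in H; rewrite ?mid_rw, ?lw_id, ?mcompA in H;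
  cbn [app] in H; rewrite ?mcomp1f, ?mcompf1 in H; rewrite <- H; clear H x.

Section TensorMonad.
Variables (M : braided) (D : bimonoid_data M).
Hypothesis W : is_weak_bimonoid D.
Implicit Types (p q l : list M) (X Y A : M) (f g : [bm_obj D] ⇒ [bm_obj D]).
Local Notation B := (bm_obj D).
Local Notation mu := (mu D).
Local Notation eta := (eta D).
Local Notation de := (de D).
Local Notation ep := (ep D).
Local Notation uu := (uu D).
Local Notation ev := (ev D).
Local Notation t := (wb_t D).
Local Notation r := (wb_r D).
Local Notation T := (tensor_weak_bimonad D).

(** With [uT], closes and opens the single object TX = X ⊗ B, which is two strands in the
    calculus. *)
Definition bT X p : X :: B :: p ⇒ T X :: p := box [X; B] ▷ p.
Definition uT X p : T X :: p ⇒ X :: B :: p := unbox [X; B] ▷ p.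

Lemma bTK X p : uT X p • bT X p = lid (X :: B :: p).
Proof. exact (boxK [X; B] p). Qed.

Lemma uTK X p : bT X p • uT X p = lid (T X :: p).
Proof. exact (unboxK [X; B] p). Qed.

Lemma bTKr X p q (k : q ⇒ X :: B :: p) : uT X p • (bT X p • k) = k.
Proof. layer (bTK X p). apply mcomp1f. Qed.

Lemma boxKr l p q (k : q ⇒ l ++ p) : unbox l ▷ p • (box l ▷ p • k) = k.
Proof. rewrite <- mcompA, boxK. apply mcomp1f. Qed.

(** * Structure maps of the bimonad in layers *)

Lemma Tm_layers l l' (f : l ⇒ l') p :
  Tm T f ▷ p = bT ⟦l'⟧ p • (box l' ▷ (B :: p) • (f ▷ (B :: p)
    • (unbox l ▷ (B :: p) • uT ⟦l⟧ p))).
Proof.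
  refine (eq_trans (pack_rw (pack f ▷ [B]) p) _).
  rewrite_cbn (rw_rw (pack f) [B] p).
  rewrite pack_rw, !mcompA. reflexivity.
Qed.

Lemma Tu_layers l p : Tu T l ▷ p = bT ⟦l⟧ p • (⟦l⟧ ◁ eta p • box l ▷ p).
Proof.
  assert (H : Tu T l = box [⟦l⟧; B] • (⟦l⟧ ◁ bm_unit D) • box l).
  { unfold mcomp, box. now rewrite comp_idl, comp_idr. }
  rewrite H, !rw_comp.
  rewrite (lw_rw ⟦l⟧ (bm_unit D) p), mcompA. reflexivity.
Qed.

Lemma m_layers X p :
  wm_mul T X ▷ p = bT X p • (X ◁ mu p • (uT X (B :: p) • uT (T X) p)).
Proof.
  assert (H : wm_mul T X = box [X; B] • (X ◁ bm_mul D) • (unbox [X; B] ▷ [B])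
     • unbox [T X; B]).
  { cbn [wm_mul tensor_weak_bimonad].
    rewrite (joinl_unbox [X; B] B []). unfold mcomp, box, unbox, pack.
    now rewrite comp_idl, comp_idr. }
  rewrite H, !rw_comp.
  rewrite (lw_rw X (bm_mul D) p), !mcompA.
  rewrite_cbn (rw_rw (unbox [X; B]) [B] p). reflexivity.
Qed.

Lemma tau_layers X Y p :
  wm_tau T X Y ▷ p = T X ◁ bT Y p • (bT X (Y :: B :: p) • (X ◁ sw Y B (B :: p)
    • (X ◁ Y ◁ de p • (unbox [X; Y] ▷ (B :: p) • uT (tens X Y) p)))).
Proof.
  assert (H : wm_tau T X Y = (T X ◁ box [Y; B]) • (box [X; B] ▷ [Y; B])
    • (mid X ⊗ mbr Y B ⊗ mid B) • (mid X ⊗ mid Y ⊗ bm_comul D)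
    • (unbox [X; Y] ▷ [B]) • unbox [tens X Y; B]).
  { cbn [wm_tau tensor_weak_bimonad].
    rewrite (joinl_unbox [X; Y] B []), (splitl_box [X; B] Y [B]).
    unfold mcomp, box, unbox, pack.
    rewrite comp_idr. do 4 f_equal. symmetry.
    etransitivity; [| apply comp_idl]. f_equal. apply (lw_id (T X) [T Y]). }
  rewrite H. clear H. rewrite !rw_comp, !mcompA.
  refine (f_equal2 (@mcomp _ _ _ _) _ (f_equal2 (@mcomp _ _ _ _) _
    (f_equal2 (@mcomp _ _ _ _) _ (f_equal2 (@mcomp _ _ _ _) _
    (f_equal2 (@mcomp _ _ _ _) _ _))))).
  - exact (lw_rw (T X) (box [Y; B]) p).
  - exact (rw_rw (box [X; B]) [Y; B] p).
  - strict_lhs. reflexivity.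
  - strict_lhs. reflexivity.
  - exact (rw_rw (unbox [X; Y]) [B] p).
  - reflexivity.
Qed.

Lemma Ttau_layers l A p :
  Tτ T l [A] ▷ p = T ⟦l⟧ ◁ bT A p • (bT ⟦l⟧ (A :: B :: p) • (⟦l⟧ ◁ sw A B (B :: p)
    • (⟦l⟧ ◁ A ◁ de p • ((box l ▷ [A]) ▷ (B :: p)
    • (unbox (l ++ [A]) ▷ (B :: p) • uT ⟦l ++ [A]⟧ p))))).
Proof.
  unfold Tτ. rewrite rw_comp. cbn [tensl].
  assert (H : wm_map T (X := ⟦l ++ [A]⟧) (Y := tens ⟦l⟧ A) (splitl l [A])
     = Tm T (l := l ++ [A]) (l' := [⟦l⟧; A]) (box l ▷ [A])).
  { unfold Tm. f_equal. exact (splitl_box l A []). }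
  cbn [tensl] in H.
  etransitivity.
  { refine (f_equal2 (@mcomp _ _ _ _) (tau_layers ⟦l⟧ A p) _).
    etransitivity; [exact (f_equal (fun z => z ▷ p) H) |].
    exact (Tm_layers (l := l ++ [A]) (l' := [⟦l⟧; A]) (box l ▷ [A]) p). }
  rewrite !mcompA. do 4 f_equal.
  cbn [tensl]. rewrite bTKr. exact (boxKr (l := [⟦l⟧; A]) (p := B :: p) _).
Qed.

(** The rebracketings between u and τ cancel, which brings δ next to η and leaves only δη. *)
Lemma Ttau_Tu_layers l A p :
  Tτ T l [A] ▷ p • Tu T (l ++ [A]) ▷ p
  = T ⟦l⟧ ◁ bT A p • (bT ⟦l⟧ (A :: B :: p) • (⟦l⟧ ◁ sw A B (B :: p)
    • (⟦l⟧ ◁ A ◁ uu p • (box l ▷ [A]) ▷ p))).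
Proof.
  rewrite Ttau_layers, Tu_layers, !mcompA.
  do 3 refine (f_equal2 (@mcomp _ _ _ _) eq_refl _).
  rewrite uuE, lw_comp, lw_comp, mcompA.
  refine (f_equal2 (@mcomp _ _ _ _) eq_refl _).
  transitivity ((box l ▷ [A]) ▷ (B :: p) • lws (l ++ [A]) (eta p)).
  - refine (f_equal2 (@mcomp _ _ _ _) eq_refl _).
    etransitivity.
    { refine (f_equal2 (@mcomp _ _ _ _) eq_refl _).
      exact (bTKr (X := ⟦l ++ [A]⟧) (p := p) _). }
    etransitivity; [| exact (boxKr (l := l ++ [A]) (p := B :: p) _)].
    refine (f_equal2 (@mcomp _ _ _ _) eq_refl _).
    exact (eq_sym (interchange (box (l ++ [A])) (eta p))).
  - exact (interchange (box l ▷ [A]) (eta p)).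
Qed.

Lemma bT_i X p p' (h : p ⇒ p') : bT X p' • X ◁ B ◁ h = T X ◁ h • bT X p.
Proof. exact (interchange (box [X; B]) h). Qed.

Lemma uT_i X p p' (h : p ⇒ p') : uT X p' • T X ◁ h = X ◁ B ◁ h • uT X p.
Proof. exact (interchange (unbox [X; B]) h). Qed.

Lemma rw1_i X Y (f : [X] ⇒ [Y]) p p' (h : p ⇒ p') :
  rw1 f p' • X ◁ h = Y ◁ h • rw1 f p.
Proof. exact (interchange f h). Qed.

(** The algebra structure read as a right action of B on the strand A. *)
Definition act A (a : [T A] ⇒ [A]) p : A :: B :: p ⇒ A :: p := rw1 a p • bT A p.

Lemma act_i A (a : [T A] ⇒ [A]) p p' (h : p ⇒ p') :
  act a p' • A ◁ B ◁ h = A ◁ h • act a p.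
Proof. unfold act. rewrite mcompA, bT_i. layer (rw1_i a h). reflexivity. Qed.

Definition E_rw A A' (a : [T A] ⇒ [A]) (a' : [T A'] ⇒ [A']) p :
  A :: A' :: p ⇒ A :: A' :: p := wm_E a a' ▷ p.

Lemma E_layers A A' (a : [T A] ⇒ [A]) (a' : [T A'] ⇒ [A']) p :
  E_rw a a' p = act a (A' :: p) • (A ◁ B ◁ act a' p
    • (A ◁ sw A' B (B :: p) • A ◁ A' ◁ uu p)).
Proof.
  unfold E_rw, wm_E. rewrite mcompA, !rw_comp.
  transitivity (rw1 a (A' :: p) • T A ◁ rw1 a' p • (T A ◁ bT A' p
    • (bT A (A' :: B :: p) • (A ◁ sw A' B (B :: p)
    • (A ◁ A' ◁ uu p))))).
  - refine (f_equal2 (@mcomp _ _ _ _) _ _).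
    + exact (mtens_rw a a' p).
    + refine (eq_trans (Ttau_Tu_layers [A] A' p) _).
      do 3 refine (f_equal2 (@mcomp _ _ _ _) eq_refl _).
      etransitivity; [| apply mcompf1].
      refine (f_equal2 (@mcomp _ _ _ _) eq_refl _).
      rewrite box1. exact (rw_id [A; A'] p).
  - rewrite !mcompA. layer (eq_sym (bT_i A (bT A' p))).
    layer (eq_sym (bT_i A (rw1 a' p))). unfold act. now rewrite ?lw_comp, ?mcompA.
Qed.

Definition u2 X Y p : tens X Y :: p ⇒ X :: Y :: p := unbox [X; Y] ▷ p.
Definition b2 X Y p : X :: Y :: p ⇒ tens X Y :: p := box [X; Y] ▷ p.

Lemma u2_i X Y p p' (h : p ⇒ p') : u2 X Y p' • tens X Y ◁ h = X ◁ Y ◁ h • u2 X Y p.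
Proof. exact (interchange (unbox [X; Y]) h). Qed.

Lemma b2_i X Y p p' (h : p ⇒ p') : b2 X Y p' • X ◁ Y ◁ h = tens X Y ◁ h • b2 X Y p.
Proof. exact (interchange (box [X; Y]) h). Qed.

Lemma u2b2 X Y p : u2 X Y p • b2 X Y p = lid (X :: Y :: p).
Proof. exact (boxK [X; Y] p). Qed.

Definition E3_rw A A' A'' (a : [T A] ⇒ [A]) (a' : [T A'] ⇒ [A'])
    (a'' : [T A''] ⇒ [A'']) p : A :: A' :: A'' :: p ⇒ A :: A' :: A'' :: p :=
  wm_E3 a a' a'' ▷ p.

Lemma E3_layers A A' A'' (a : [T A] ⇒ [A]) (a' : [T A'] ⇒ [A'])
    (a'' : [T A''] ⇒ [A'']) p :
  E3_rw a a' a'' p = act a (A' :: A'' :: p) • (A ◁ B ◁ act a' (A'' :: p)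
    • (A ◁ B ◁ A' ◁ B ◁ act a'' p • (A ◁ sw A' B (B :: A'' :: B :: p)
    • (A ◁ A' ◁ de (A'' :: B :: p) • (A ◁ A' ◁ sw A'' B (B :: p)
    • A ◁ A' ◁ A'' ◁ uu p))))).
Proof.
  unfold E3_rw, wm_E3, Tτ3. rewrite !rw_comp, !mcompA.
  transitivity ((rw1 a (A' :: A'' :: p) • (T A ◁ rw1 a' (A'' :: p)
    • T A ◁ T A' ◁ rw1 a'' p)) • ((T A ◁ bT A' (T A'' :: p)
    • (bT A (A' :: B :: T A'' :: p) • (A ◁ sw A' B (B :: T A'' :: p)
    • (A ◁ A' ◁ de (T A'' :: p)
    • (u2 A A' (B :: T A'' :: p) • uT (tens A A') (T A'' :: p))))))
    • (T (tens A A') ◁ bT A'' p • (bT (tens A A') (A'' :: B :: p)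
    • (tens A A' ◁ sw A'' B (B :: p) • (tens A A' ◁ A'' ◁ uu p
    • b2 A A' (A'' :: p))))))).
  - refine (f_equal2 (@mcomp _ _ _ _) _ (f_equal2 (@mcomp _ _ _ _) _ _)).
    + strict_lhs. reflexivity.
    + transitivity (Tτ T [A] [A'] ▷ (T A'' :: p)); [strict_lhs; reflexivity |].
      refine (eq_trans (Ttau_layers [A] A' (T A'' :: p)) _).
      do 4 refine (f_equal2 (@mcomp _ _ _ _) eq_refl _).
      refine (eq_trans _ (mcomp1f _)). refine (f_equal2 (@mcomp _ _ _ _) _ eq_refl).
      rewrite box1. exact (rw_id [A; A'] (B :: T A'' :: p)).
    + refine (eq_trans (Ttau_Tu_layers [A; A'] A'' p) _).
      do 4 refine (f_equal2 (@mcomp _ _ _ _) eq_refl _).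
      exact (rw_rw (box [A; A']) [A''] p).
  - rewrite !mcompA. layer (uT_i (tens A A') (bT A'' p)). rewrite bTKr.
    layer (u2_i A A' (B ◁ bT A'' p)).
    layer (u2_i A A' (sw A'' B (B :: p))).
    layer (u2_i A A' (A'' ◁ uu p)).
    rewrite u2b2, mcompf1.
    layer (lw_eq2 A (lw_eq2 A' (de_i D (bT A'' p)))).
    layer (lw_eq2 A (sw_i (B ◁ bT A'' p) A' B)).
    layer (eq_sym (bT_i A (bT A' (T A'' :: p)))).
    layer (eq_sym (bT_i A (T A' ◁ rw1 a'' p))).
    layer (lw_eq2 A (lw_eq2 B (eq_sym (bT_i A' (rw1 a'' p))))).
    layer (eq_sym (bT_i A (rw1 a' (A'' :: p)))).
    unfold act. now rewrite ?lw_comp, ?mcompA.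
Qed.

Lemma act_m X p : act (wm_mul T X) p = bT X p • (X ◁ mu p • uT X (B :: p)).
Proof.
  unfold act. refine (eq_trans (f_equal (fun z => z • bT (T X) p) (m_layers X p)) _).
  now rewrite !mcompA, bTK, mcompf1.
Qed.

Local Notation K := (munit (m := M)).

Definition b0 p : p ⇒ K :: p := box [] ▷ p.
Definition u0 p : K :: p ⇒ p := unbox [] ▷ p.

Lemma b0_i p p' (h : p ⇒ p') : b0 p' • h = K ◁ h • b0 p.
Proof. exact (interchange (box []) h). Qed.

Lemma u0_i p p' (h : p ⇒ p') : u0 p' • K ◁ h = h • u0 p.
Proof. exact (interchange (unbox []) h). Qed.

Lemma u0b0 p : u0 p • b0 p = lid p.
Proof. exact (boxK [] p). Qed.

Lemma b0u0 p : b0 p • u0 p = lid (K :: p).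
Proof. exact (unboxK [] p). Qed.

(** With [kU], the identification of TK = K ⊗ B with B. *)
Definition kT p : B :: p ⇒ T K :: p := bT K p • b0 (B :: p).
Definition kU p : T K :: p ⇒ B :: p := u0 (B :: p) • uT K p.

Lemma kTK p : kU p • kT p = lid (B :: p).
Proof. unfold kU, kT. rewrite mcompA, bTKr. apply u0b0. Qed.

Lemma kT_i p p' (h : p ⇒ p') : kT p' • B ◁ h = T K ◁ h • kT p.
Proof. unfold kT. rewrite mcompA, b0_i. layer (bT_i K h). reflexivity. Qed.

Lemma kU_i p p' (h : p ⇒ p') : kU p' • T K ◁ h = B ◁ h • kU p.
Proof. unfold kU. rewrite mcompA, uT_i. layer (u0_i (B ◁ h)). reflexivity. Qed.

Lemma kU_sw X p : sw B X p • kU (X :: p) = X ◁ kU p • sw (T K) X p.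
Proof.
  assert (H : forall q, kU q = rw1 (unbox [] ▷ [B] • unbox [K; B]) q).
  { intros q. unfold rw1. rewrite rw_comp.
    exact (f_equal (fun z => z • uT K q) (eq_sym (rw_rw (unbox []) [B] q))). }
  rewrite !H. exact (sw_natl X _ p).
Qed.

Lemma act_mK p : act (wm_mul T K) p = kT p • (mu p • (u0 (B :: B :: p) • uT K (B :: p))).
Proof.
  rewrite act_m. unfold kT. rewrite mcompA. layer (b0_i (mu p)).
  layer (b0u0 (B :: B :: p)). now rewrite mcomp1f.
Qed.

Lemma tau0_layers p : wm_tau0 T ▷ p = ep p • kU p.
Proof.
  assert (H : wm_tau0 T = bm_counit D • (unbox [] ▷ [B]) • unbox [K; B]).
  { cbn [wm_tau0 tensor_weak_bimonad]. rewrite (joinl_unbox [] B []).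
    unfold mcomp, box, unbox, pack. now rewrite comp_idr. }
  rewrite H, !rw_comp, !mcompA.
  refine (f_equal2 (@mcomp _ _ _ _) eq_refl (f_equal2 (@mcomp _ _ _ _) _ eq_refl)).
  exact (rw_rw (unbox []) [B] p).
Qed.

(** The counit applied to the product under τ_0 is the pairing ε(b 1_2), so the idempotent is t
    transported to TK, and R splits t. *)
Lemma sqcap_layers p : rw1 (wm_sqcap T) p = kT p • (rwB t p • kU p).
Proof.
  transitivity (T K ◁ (ep p • kU p) • (T K ◁ rw1 (wm_mul T K) p •
     (T K ◁ bT (T K) p • (bT K (T K :: B :: p) • (K ◁ sw (T K) B (B :: p)
    • (K ◁ T K ◁ uu p • b0 (T K :: p))))))).
  - unfold rw1, wm_sqcap. rewrite rw_comp, rw_comp, mcompA, rw_comp, mcompA.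
    refine (f_equal2 (@mcomp _ _ _ _) _ (f_equal2 (@mcomp _ _ _ _) _ _)).
    + rewrite <- tau0_layers. strict_lhs. reflexivity.
    + strict_lhs. reflexivity.
    + refine (eq_trans (Ttau_Tu_layers [] (T K) p) _).
      do 4 refine (f_equal2 (@mcomp _ _ _ _) eq_refl _).
      exact (rw_rw (box []) [T K] p).
  - transitivity (T K ◁ (ev p • kU (B :: p)) • (bT K (T K :: B :: p)
      • (K ◁ sw (T K) B (B :: p) • (K ◁ T K ◁ uu p • b0 (T K :: p))))).
    + rewrite (mcomp_eq2 _ (lw_eq2 (T K) (act_mK p : rw1 (wm_mul T K) p • bT (T K) p = _))).
      rewrite <- mcompA, <- lw_comp. do 2 f_equal.
      rewrite !mcompA. layer (kTK p). rewrite mcomp1f, evE, mcompA. reflexivity.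
    + rewrite lw_comp, mcompA. layer (eq_sym (bT_i K (kU (B :: p)))). layer (eq_sym (bT_i K (ev p))).
      layer (lw_eq2 K (eq_sym (kU_sw _ _))). layer (lw_eq2 K (kU_i (uu p))).
      rewrite t_layers. unfold kT. rewrite !mcompA.
      layer (eq_sym (b0_i (kU p))). layer (eq_sym (b0_i (B ◁ uu p))).
      layer (eq_sym (b0_i (sw B B (B :: p)))). layer (eq_sym (b0_i (B ◁ ev p))). reflexivity.
Qed.
(* The composite [β_A (P ⊗ A)]: [b ⊗ x ↦ ε(b 1_1) x 1_2]. *)
Definition betaB A (a : [T A] ⇒ [A]) p : B :: A :: p ⇒ A :: p :=
  ev (A :: p) • (B ◁ B ◁ act a p • (B ◁ sw A B (B :: p) • B ◁ A ◁ uu p)).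

(** * Action of the base on free algebras *)

Definition Tu2 X Y p : X :: Y :: p ⇒ T (tens X Y) :: p := Tu T [X; Y] ▷ p.

Lemma Tu2_i X Y p p' (h : p ⇒ p') :
  Tu2 X Y p' • X ◁ Y ◁ h = T (tens X Y) ◁ h • Tu2 X Y p.
Proof. exact (interchange (Tu T [X; Y]) h). Qed.

(* [w ⊗ x ↦ ε(w 1_1) x ⊗ 1_2] for [x] in the tensor product of [l]. *)
Definition slide l q : B :: l ++ q ⇒ l ++ B :: q :=
  ev (l ++ B :: q) • (B ◁ xl l B (B :: q) • B ◁ lws l (uu q)).

Lemma slide_nat l l' (f : l ⇒ l') q :
  slide l' q • B ◁ (f ▷ q) = f ▷ (B :: q) • slide l q.
Proof.
  unfold slide. rewrite !mcompA.
  rewrite <- (lw_comp B (lws l' (uu q))), <- (interchange f (uu q)), lw_comp.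
  rewrite <- (mcompA (B ◁ xl _ _ _)), <- lw_comp, (xl_nat B f (B :: q)), lw_comp.
  rewrite mcompA, <- (mcompA (ev _)), ev_i, mcompA. reflexivity.
Qed.

(** If w has just come from the right of X, naturality of the braiding against the pairing absorbs
    both crossings and X stays outside. *)
Lemma slide_cons X l q :
  slide (X :: l) q • sw X B (l ++ q) = X ◁ slide l q.
Proof.
  unfold slide. rewrite xl_cons. cbn [lws app]. rewrite !lw_comp, !mcompA.
  rewrite <- (sw_i (lws l (uu q)) X B).
  layer (eq_sym (sw_i (xl l B (B :: q)) X B)).
  rewrite sw_ev, !mcompA. reflexivity.
Qed.

Definition slide0 q : B :: q ⇒ B :: q := slide [] q.
Definition slide1 X q : B :: X :: q ⇒ X :: B :: q := slide [X] q.
Definition slide2 X Y q : B :: X :: Y :: q ⇒ X :: Y :: B :: q := slide [X; Y] q.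
Definition slide3 X Y Z q : B :: X :: Y :: Z :: q ⇒ X :: Y :: Z :: B :: q :=
  slide [X; Y; Z] q.

Lemma slide0E q : slide0 q = ev (B :: q) • B ◁ uu q.
Proof.
  unfold slide0, slide. rewrite xl_nil, lw_id.
  exact (f_equal2 (@mcomp _ _ _ _) eq_refl (mcomp1f _)).
Qed.

Lemma slide2E X Y q :
  slide2 X Y q = ev (X :: Y :: B :: q) • (B ◁ sw X B (Y :: B :: q)
    • (B ◁ X ◁ sw Y B (B :: q) • B ◁ X ◁ Y ◁ uu q)).
Proof.
  unfold slide2, slide. rewrite !xl_cons, xl_nil, lw_id, mcompf1. cbn [lws app].
  now rewrite !lw_comp, !mcompA.
Qed.

Lemma slide1_sw X q : slide1 X q • sw X B q = X ◁ slide0 q.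
Proof. exact (slide_cons X [] q). Qed.

Lemma slide2_sw X Y q : slide2 X Y q • sw X B (Y :: q) = X ◁ slide1 Y q.
Proof. exact (slide_cons X [Y] q). Qed.

Lemma slide3_sw X Y Z q : slide3 X Y Z q • sw X B (Y :: Z :: q) = X ◁ slide2 Y Z q.
Proof. exact (slide_cons X [Y; Z] q). Qed.

Lemma uT_sw X Z q :
  Z ◁ uT X q • sw (T X) Z q = sw X Z (B :: q) • (X ◁ sw B Z q • uT X (Z :: q)).
Proof. rewrite <- mcompA. symmetry. crossing (xl_nat Z (unbox [X; B]) q). Qed.

Lemma betaB_m X p :
  uT X p • betaB (wm_mul T X) p = X ◁ mu p • (slide2 X B p • B ◁ uT X p).
Proof.
  rewrite slide2E. unfold betaB.
  layer (eq_sym (ev_i D (uT X p))). rewrite act_m, !lw_comp, !mcompA.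
  layer (lw_eq2 B (lw_eq2 B (bTK X p))). rewrite !lw_id, mcomp1f.
  layer (lw_eq2 B (uT_sw X B (B :: p))). layer (lw_eq2 B (uT_i X (uu p))).
  layer (ev_i D (X ◁ mu p)). reflexivity.
Qed.

(** On the image of the unit the last factor is 1, so the multiplication by 1_2 in the action
    disappears and a bare [slide] remains. *)
Lemma betaB_m_Tu X Y p :
  uT (tens X Y) p • (betaB (wm_mul T (tens X Y)) p • B ◁ Tu2 X Y p)
  = b2 X Y (B :: p) • slide2 X Y p.
Proof.
  assert (E1 : slide2 (tens X Y) B p • B ◁ tens X Y ◁ eta p
    = tens X Y ◁ eta (B :: p) • slide1 (tens X Y) p).
  { pose proof (slide_nat (tens X Y ◁ bm_unit D : [tens X Y] ⇒ [tens X Y; B]) p) as H.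
    rewrite !lw_rw in H. exact H. }
  assert (E2 : slide1 (tens X Y) p • B ◁ b2 X Y p = b2 X Y (B :: p) • slide2 X Y p)
    by exact (slide_nat (box [X; Y]) p).
  assert (E3 : Tu2 X Y p = bT (tens X Y) p • (tens X Y ◁ eta p • b2 X Y p))
    by exact (Tu_layers [X; Y] p).
  layer (betaB_m _ _). rewrite E3, !lw_comp. layer (lw_eq2 B (bTK (tens X Y) p)).
  rewrite !lw_id, mcomp1f. layer E1. layer (lw_eq2 (tens X Y) (mu1l W p)).
  rewrite lw_id, mcomp1f. exact E2.
Qed.

(** F with R and the rebracketings removed. Of the two legs of 1_1 ⊗ 1_2, the second acts on TX
    through the inner [slide]; the first goes past TX ⊗ Y through the outer one and ends in the last
    B. *)
Definition coreF X Y p : X :: B :: Y :: B :: p ⇒ X :: B :: Y :: B :: p :=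
  X ◁ B ◁ Y ◁ mu p • (slide3 X B Y (B :: p)
    • (B ◁ X ◁ mu (Y :: B :: p) • (B ◁ slide2 X B (Y :: B :: p)
    • uu (X :: B :: Y :: B :: p)))).

Lemma slide_uu q : B ◁ slide0 q • uu q = uu q.
Proof.
  rewrite slide0E, lw_comp, mcompA, <- uu_i. apply uu_ev_uu, W.
Qed.

(** Sliding 1_1 past 1_2 pairs it with a fresh 1'_1, and ε(1_1 1'_1) 1_2 is r(1'_1). *)
Lemma slide_pair_uu Y q :
  slide2 B Y q • uu (Y :: q) = rwB r (Y :: B :: q) • (sw Y B (B :: q) • Y ◁ uu q).
Proof.
  rewrite slide2E, !mcompA.
  rewrite <- (uu_i D (Y ◁ uu q)). layer (eq_sym (uu_i D (sw Y B (B :: q)))).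
  rewrite (mcomp_eq3 _ (eq_sym (r_layers D (Y :: B :: q)))). reflexivity.
Qed.

Lemma slide2_mu Y q :
  slide2 B Y q • B ◁ mu (Y :: q) = mu (Y :: B :: q) • slide3 B B Y q.
Proof.
  pose proof (slide_nat (bm_mul D ▷ [Y] : [B; B; Y] ⇒ [B; Y]) q) as H.
  pose proof (rw_rw (bm_mul D) [Y] q : (bm_mul D ▷ [Y]) ▷ q = mu (Y :: q)) as H1.
  pose proof (rw_rw (bm_mul D) [Y] (B :: q)
    : (bm_mul D ▷ [Y]) ▷ (B :: q) = mu (Y :: B :: q)) as H2.
  refine (eq_trans (f_equal (fun z => slide2 B Y q • B ◁ z) (eq_sym H1)) _).
  refine (eq_trans H _). exact (f_equal (fun z => z • slide3 B B Y q) H2).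
Qed.

Lemma slide2_uT X Y q :
  uT X (Y :: B :: q) • slide2 (T X) Y q = slide3 X B Y q • B ◁ uT X (Y :: q).
Proof.
  pose proof (slide_nat (unbox [X; B] ▷ [Y] : [T X; Y] ⇒ [X; B; Y]) q) as H.
  pose proof (rw_rw (unbox [X; B]) [Y] q
    : (unbox [X; B] ▷ [Y]) ▷ q = uT X (Y :: q)) as H1.
  pose proof (rw_rw (unbox [X; B]) [Y] (B :: q)
    : (unbox [X; B] ▷ [Y]) ▷ (B :: q) = uT X (Y :: B :: q)) as H2.
  refine (eq_trans (f_equal (fun z => z • slide2 (T X) Y q) (eq_sym H2)) _).
  refine (eq_trans (eq_sym H) _).
  exact (f_equal (fun z => slide3 X B Y q • B ◁ z) H1).
Qed.

(** Creating δη to the right of X and then of the first B lets [slide_cons] absorb the slides past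
    them. The inner slide is then trivial by [slide_uu], and the outer one becomes r by
    [slide_pair_uu]. *)
Lemma coreF_ygalois X Y p : coreF X Y p = X ◁ ygalois r Y p.
Proof.
  transitivity (X ◁ (B ◁ Y ◁ mu p • (slide2 B Y (B :: p)
    • (B ◁ mu (Y :: B :: p) • (B ◁ slide1 B (Y :: B :: p)
    • uu (B :: Y :: B :: p)))))).
  { unfold coreF. rewrite <- (sw_uu D X (B :: Y :: B :: p)), !lw_comp.
    layer (lw_eq2 B (slide2_sw X B (Y :: B :: p))).
    layer (eq_sym (sw_i (slide1 B (Y :: B :: p)) X B)).
    layer (eq_sym (sw_i (mu (Y :: B :: p)) X B)).
    layer (slide3_sw X B Y (B :: p)). reflexivity. }
  f_equal. rewrite <- (ygalois_r W), <- (sw_uu D B (Y :: B :: p)).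
  layer (lw_eq2 B (slide1_sw B (Y :: B :: p))).
  layer (eq_sym (sw_i (slide0 (Y :: B :: p)) B B)).
  layer (slide2_mu Y (B :: p)). layer (slide3_sw B B Y (B :: p)).
  layer (eq_sym (mu_i D (Y ◁ mu p))).
  layer (lw_eq2 B (slide_uu (Y :: B :: p))).
  layer (lw_eq2 B (slide_pair_uu Y (B :: p))). reflexivity.
Qed.

(** * The morphisms can and E in terms of Φ *)

Definition uE X Y p : T X :: T Y :: p ⇒ X :: B :: Y :: B :: p :=
  uT X (Y :: B :: p) • T X ◁ uT Y p.
Definition bE X Y p : X :: B :: Y :: B :: p ⇒ T X :: T Y :: p :=
  T X ◁ bT Y p • bT X (Y :: B :: p).
Definition uF X Y p : T (tens (T X) Y) :: p ⇒ X :: B :: Y :: B :: p :=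
  uT X (Y :: B :: p) • (u2 (T X) Y (B :: p) • uT (tens (T X) Y) p).
Definition bF X Y p : X :: B :: Y :: B :: p ⇒ T (tens (T X) Y) :: p :=
  bT (tens (T X) Y) p • (b2 (T X) Y (B :: p) • bT X (Y :: B :: p)).

Lemma bEK X Y p : uE X Y p • bE X Y p = lid (X :: B :: Y :: B :: p).
Proof.
  unfold uE, bE. rewrite mcompA. layer (lw_eq2 (T X) (bTK Y p)).
  rewrite lw_id, mcomp1f. apply bTK.
Qed.

Lemma bFK X Y p : uF X Y p • bF X Y p = lid (X :: B :: Y :: B :: p).
Proof.
  unfold uF, bF. rewrite !mcompA, bTKr. layer (u2b2 (T X) Y (B :: p)).
  rewrite mcomp1f. apply bTK.
Qed.

Lemma can_galois X Y p :
  wm_can T X Y ▷ p = bE X Y p • (X ◁ ygalois (mid B) Y p • uF X Y p).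
Proof.
  transitivity (rw1 (wm_mul T X) (T Y :: p) • (T (T X) ◁ bT Y p
    • (bT (T X) (Y :: B :: p) • (T X ◁ sw Y B (B :: p) • (T X ◁ Y ◁ de p
    • (u2 (T X) Y (B :: p) • uT (tens (T X) Y) p)))))).
  - unfold wm_can. rewrite rw_comp.
    refine (f_equal2 (@mcomp _ _ _ _) _ _); [strict_lhs; reflexivity |].
    refine (eq_trans (Ttau_layers [T X] Y p) _).
    do 4 refine (f_equal2 (@mcomp _ _ _ _) eq_refl _).
    refine (eq_trans (f_equal2 (@mcomp _ _ _ _) _ eq_refl) (mcomp1f _)).
    refine (eq_trans (f_equal (fun z => z ▷ (B :: p)) (box1 (T X) [Y])) _).
    exact (rw_id [T X; Y] (B :: p)).
  - layer (rw1_i (wm_mul T X) (bT Y p)).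
    rewrite (mcomp_eq2 _ (act_m X (Y :: B :: p)
      : rw1 (wm_mul T X) (Y :: B :: p) • bT (T X) (Y :: B :: p) = _)), !mcompA.
    layer (uT_i X (sw Y B (B :: p))). layer (uT_i X (Y ◁ de p)).
    rewrite (mcomp_eq3 _ (lw_eq3 X (ygalois_id D Y p))). unfold bE, uF. now rewrite !mcompA.
Qed.

Lemma E_galois X Y p :
  E_rw (wm_mul T X) (wm_mul T Y) p = bE X Y p • (X ◁ ygalois t Y p • uE X Y p).
Proof.
  rewrite E_layers, !act_m, !lw_comp, !mcompA.
  layer (uT_i X (B ◁ bT Y p)). layer (uT_i X (B ◁ Y ◁ mu p)).
  layer (uT_i X (B ◁ uT Y (B :: p))). layer (uT_i X (sw (T Y) B (B :: p))).
  layer (uT_i X (T Y ◁ uu p)).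
  layer (lw_eq2 X (mu_i D (bT Y p))). layer (bT_i X (bT Y p)).
  layer (lw_eq2 X (lw_eq2 B (uT_sw Y B (B :: p)))).
  layer (lw_eq2 X (lw_eq2 B (uT_i Y (uu p)))).
  rewrite <- (ygalois_t W). unfold bE, uE. rewrite !lw_comp, !mcompA.
  layer (uT_i X (uT Y p)). reflexivity.
Qed.

(** * Removing the base object from F *)

Section Base.
Variable S : splitting (X := T K) (wm_sqcap T).
Local Notation R := (spl_obj S).

Definition prR p : B :: p ⇒ R :: p := rw1 (spl_proj S : [T K] ⇒ [R]) p • kT p.
Definition inR p : R :: p ⇒ B :: p := kU p • rw1 (spl_incl S : [R] ⇒ [T K]) p.

(** This is how R disappears: the resulting t is absorbed through [ep_t], [ev_t] or [t_eta]. *)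
Lemma inR_prR p : inR p • prR p = rwB t p.
Proof.
  unfold inR, prR. rewrite mcompA.
  assert (H : rw1 (spl_incl S : [R] ⇒ [T K]) p • rw1 (spl_proj S : [T K] ⇒ [R]) p
    = rw1 (wm_sqcap T) p).
  { refine (eq_trans (eq_sym (rw_comp (spl_incl S : [R] ⇒ [T K])
      (spl_proj S : [T K] ⇒ [R]) p)) _).
    exact (f_equal (fun z : [T K] ⇒ [T K] => rw1 z p) (spl_inclproj S)). }
  layer H. rewrite sqcap_layers, !mcompA, kTK, mcompf1, (mcomp_eq2 _ (kTK p)).
  apply mcomp1f.
Qed.

Lemma prR_i p p' (h : p ⇒ p') : prR p' • B ◁ h = R ◁ h • prR p.
Proof. unfold prR. rewrite mcompA, kT_i. layer (rw1_i _ h). reflexivity. Qed.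

Lemma act_R p : act (R_act S) p = prR p • (mu p • inR (B :: p)).
Proof.
  transitivity (rw1 (spl_proj S : [T K] ⇒ [R]) p • (rw1 (wm_mul T K) p •
    ((bT (T K) p • (rw1 (spl_incl S : [R] ⇒ [T K]) (B :: p) • uT R p)) • bT R p))).
  - unfold act, R_act, rw1. rewrite !rw_comp, !mcompA.
    do 2 refine (f_equal2 (@mcomp _ _ _ _) eq_refl _).
    refine (eq_trans (f_equal (fun z => z • bT R p)
      (Tm_layers (l := [R]) (l' := [T K]) (spl_incl S) p)) _).
    rewrite !mcompA. refine (f_equal2 (@mcomp _ _ _ _) eq_refl _).
    refine (eq_trans (f_equal2 (@mcomp _ _ _ _) (box1 _ _) eq_refl) _).
    refine (eq_trans (mcomp1f _) (f_equal2 (@mcomp _ _ _ _) eq_refl _)).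
    exact (eq_trans (f_equal2 (@mcomp _ _ _ _) (unbox1 _ _) eq_refl) (mcomp1f _)).
  - rewrite !mcompA, bTK, mcompf1.
    rewrite (mcomp_eq2 _ (act_mK p : rw1 (wm_mul T K) p • bT (T K) p = _)), !mcompA.
    unfold prR, inR. rewrite !mcompA. unfold kU. now rewrite !mcompA.
Qed.

Lemma R_unit_layers p : R_unit S ▷ p = prR p • eta p.
Proof.
  unfold R_unit. rewrite rw_comp. unfold prR, kT. rewrite !mcompA.
  refine (f_equal2 (@mcomp _ _ _ _) eq_refl _).
  refine (eq_trans (Tu_layers [] p) _).
  refine (f_equal2 (@mcomp _ _ _ _) eq_refl _).
  exact (eq_sym (b0_i (eta p))).
Qed.

Lemma R_counit_layers p : R_counit S ▷ p = ep p • inR p.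
Proof.
  unfold R_counit. rewrite rw_comp. unfold inR. rewrite <- mcompA.
  exact (f_equal (fun z => z • _) (tau0_layers p)).
Qed.

Definition beta_rw A (a : [T A] ⇒ [A]) p : R :: A :: p ⇒ A :: p := wm_beta S a ▷ p.
Definition rho_rw A (a : [T A] ⇒ [A]) p : R :: A :: R :: p ⇒ A :: p := wm_rho S a ▷ p.

Lemma beta_layers A (a : [T A] ⇒ [A]) p :
  beta_rw a p = ep (A :: p) • (inR (A :: p) • E_rw (R_act S) a p).
Proof.
  unfold beta_rw, wm_beta. rewrite rw_comp, <- mcompA.
  refine (f_equal2 (@mcomp _ _ _ _) _ eq_refl).
  rewrite <- R_counit_layers. unfold R_counit. strict_lhs. reflexivity.
Qed.

Lemma rho_layers A (a : [T A] ⇒ [A]) p :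
  rho_rw a p = ep (A :: p) • (inR (A :: p) • (R ◁ A ◁ (ep p • inR p)
    • E3_rw (R_act S) a (R_act S) p)).
Proof.
  unfold rho_rw, wm_rho. rewrite rw_comp, <- (mcompA (inR _)), <- mcompA.
  refine (f_equal2 (@mcomp _ _ _ _) _ eq_refl).
  rewrite <- mcompA, <- R_counit_layers, <- R_counit_layers.
  unfold R_counit. strict_lhs. reflexivity.
Qed.

(** The value is ε(t(t(b) b')): [ep_t] removes the outer t and [ev_t] the inner one. *)
Lemma eps_act_prR p : ep p • (inR p • (act (R_act S) p • prR (B :: p))) = ev p.
Proof.
  rewrite act_R, !mcompA, inR_prR. layer (inR_prR p). layer (ep_t W p).
  rewrite <- (mcompA (ep p)), <- evE. apply ev_t, W.
Qed.

Lemma beta_prR A (a : [T A] ⇒ [A]) p : beta_rw a p • prR (A :: p) = betaB a p.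
Proof.
  rewrite beta_layers, E_layers, !mcompA.
  layer (eq_sym (prR_i (A ◁ uu p))). layer (eq_sym (prR_i (sw A B (B :: p)))).
  layer (eq_sym (prR_i (B ◁ act a p))).
  rewrite (mcomp_eq4 _ (eps_act_prR (A :: p))). reflexivity.
Qed.

Lemma R_unit_sw X p : sw R X p • R_unit S ▷ (X :: p) = X ◁ (R_unit S ▷ p).
Proof. crossing (xl_nat X (R_unit S) p). Qed.

Definition unR p : p ⇒ R :: p := R_unit S ▷ p.

Lemma unR_i p p' (h : p ⇒ p') : unR p' • h = R ◁ h • unR p.
Proof. exact (interchange (R_unit S) h). Qed.

(** Acting on the unit of R gives P(t(1) b), and t(1) = 1. *)
Lemma act_unR p : act (R_act S) p • unR (B :: p) = prR p.
Proof.
  unfold unR. rewrite R_unit_layers, act_R, !mcompA. layer (inR_prR (B :: p)).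
  rewrite (t_eta W), (mu1l W). apply mcompf1.
Qed.

(** The third leg of the iterated coproduct of 1 acts on the unit of R and is evaluated to ε(t(1_3))
    = ε(1_3), so the counit law leaves the two legs used by β. *)
Lemma rho_unR A (a : [T A] ⇒ [A]) p :
  rho_rw a p • R ◁ A ◁ unR p = beta_rw a p.
Proof.
  rewrite rho_layers, E3_layers, beta_layers, E_layers, !mcompA, ?lw_comp, ?mcompA.
  layer (lw_eq2 R (lw_eq2 A (eq_sym (unR_i (uu p))))).
  layer (lw_eq2 R (lw_eq2 A (R_unit_sw B (B :: p) : sw R B (B :: p) • unR (B :: B :: p) = _))).
  layer (lw_eq2 R (lw_eq2 A (de_i D (unR (B :: p))))).
  layer (lw_eq2 R (sw_i (B ◁ unR (B :: p)) A B)).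
  layer (lw_eq2 R (lw_eq2 B (lw_eq2 A (lw_eq2 B (act_unR p))))).
  layer (eq_sym (act_i (R_act S) (A ◁ inR p))).
  layer (lw_eq2 R (lw_eq2 B (eq_sym (act_i a (inR p))))).
  layer (lw_eq2 R (lw_eq2 B (lw_eq2 A (lw_eq2 B (inR_prR p))))).
  layer (eq_sym (act_i (R_act S) (A ◁ ep p))).
  layer (lw_eq2 R (lw_eq2 B (eq_sym (act_i a (ep p))))).
  layer (lw_eq2 R (lw_eq2 B (lw_eq2 A (lw_eq2 B (ep_t W p))))).
  layer (lw_eq2 R (eq_sym (sw_i (B ◁ ep p) A B))).
  layer (lw_eq2 R (lw_eq2 A (eq_sym (de_i D (ep p))))).
  layer (lw_eq2 R (lw_eq2 A (ep_uu W p))).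
  layer (lw_eq2 R (lw_eq2 A (eq_sym (uuE D p)))). reflexivity.
Qed.

(** E lets 1_1 and 1_2 act on two units of R, and each action is P by [act_unR]. *)
Lemma R_comul_unit p : (R_comul S • R_unit S) ▷ p = prR (R :: p) • (B ◁ prR p • uu p).
Proof.
  transitivity (E_rw (R_act S) (R_act S) p • (R ◁ unR p • unR p)).
  { unfold R_comul, R_unit. rewrite !rw_comp, mcompA.
    refine (f_equal2 (@mcomp _ _ _ _) eq_refl (f_equal2 (@mcomp _ _ _ _) _
      (eq_sym (rw_comp _ _ p)))).
    unfold unR, R_unit. strict_lhs. reflexivity. }
  rewrite E_layers, !mcompA.
  layer (lw_eq2 R (eq_sym (unR_i (uu p)))).
  layer (lw_eq2 R (R_unit_sw B (B :: p) : sw R B (B :: p) • unR (B :: B :: p) = _)).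
  layer (lw_eq2 R (lw_eq2 B (act_unR p))).
  layer (eq_sym (unR_i (uu p))).
  layer (eq_sym (unR_i (B ◁ prR p))).
  layer (act_unR (R :: p)). reflexivity.
Qed.

Lemma Tm_comp l l' l'' (g : l' ⇒ l'') (f : l ⇒ l') : Tm T (g • f) = Tm T g • Tm T f.
Proof.
  refine (eq_trans _ (mtens_comp (pack g) (pack f) (mid B) (mid B))).
  exact (f_equal (fun z => pack (g • f) ⊗ z) (eq_sym (mcomp1f (mid B)))).
Qed.

Lemma betaw_i A (a : [T A] ⇒ [A]) p p' (h : p ⇒ p') :
  beta_rw a p' • R ◁ A ◁ h = A ◁ h • beta_rw a p.
Proof. exact (interchange (wm_beta S a) h). Qed.

Lemma mid_mtens_mid X X' Y Y' Z (f : [Y; Y'] ⇒ [Z]) p :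
  (mid X ⊗ f ⊗ mid X') ▷ p = X ◁ (f ▷ (X' :: p)).
Proof. strict_lhs. reflexivity. Qed.

Lemma F_layers X Y p :
  wm_F S X Y ▷ p = bT (tens (T X) Y) p • (tens (T X) Y ◁ mu p
    • (uT (tens (T X) Y) (B :: p)
    • (rho_rw (wm_mul T (tens (T X) Y)) (B :: p)
    • (R ◁ Tu2 (T X) Y (R :: B :: p)
    • (R ◁ beta_rw (wm_mul T X) (Y :: R :: B :: p)
    • (prR (R :: T X :: Y :: R :: B :: p)
    • (B ◁ prR (T X :: Y :: R :: B :: p) • (uu (T X :: Y :: R :: B :: p)
    • (T X ◁ Y ◁ unR (B :: p) • (u2 (T X) Y (B :: p) • uT (tens (T X) Y) p)))))))))).
Proof.
  (* All morphisms under T are merged into one, so that T is opened into strands a single time. *)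
  set (G := wm_rho S (wm_mul T (tens (T X) Y)) • (⟨R⟩ ⊗ Tu T [T X; Y] ⊗ ⟨R⟩)
    • (⟨R⟩ ⊗ wm_beta S (wm_mul T X) ⊗ ⟨Y⟩ ⊗ ⟨R⟩)
    • ((R_comul S • R_unit S) ⊗ ⟨T X⟩ ⊗ ⟨Y⟩ ⊗ R_unit S)
    : [T X; Y] ⇒ [T (tens (T X) Y)]).
  assert (H : wm_F S X Y = wm_mul T (tens (T X) Y) • Tm T G).
  { unfold G. rewrite !Tm_comp, <- !mcompA. reflexivity. }
  rewrite H. clear H. rewrite rw_comp.
  refine (eq_trans (f_equal2 (@mcomp _ _ _ _) (m_layers (tens (T X) Y) p)
    (Tm_layers G p)) _).
  rewrite !mcompA. do 3 refine (f_equal2 (@mcomp _ _ _ _) eq_refl _).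
  refine (eq_trans (bTKr (X := T (tens (T X) Y)) (p := p) _) _).
  refine (eq_trans (f_equal2 (@mcomp _ _ _ _) (box1 _ _) eq_refl) _).
  refine (eq_trans (mcomp1f _) _).
  transitivity ((rho_rw (wm_mul T (tens (T X) Y)) (B :: p)
    • (R ◁ Tu2 (T X) Y (R :: B :: p)
    • (R ◁ beta_rw (wm_mul T X) (Y :: R :: B :: p)
    • ((R_comul S • R_unit S) ▷ (T X :: Y :: R :: B :: p)
    • T X ◁ Y ◁ unR (B :: p))))) • (u2 (T X) Y (B :: p) • uT (tens (T X) Y) p)).
  - refine (f_equal2 (@mcomp _ _ _ _) _ eq_refl).
    unfold G. rewrite rw_comp, rw_comp, rw_comp, !mcompA.
    refine (f_equal2 (@mcomp _ _ _ _) eq_refl (f_equal2 (@mcomp _ _ _ _) _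
      (f_equal2 (@mcomp _ _ _ _) _ _))).
    + exact (mid_mtens_mid R R (Tu T [T X; Y]) (B :: p)).
    + strict_lhs. reflexivity.
    (* Naming the composite keeps it a single layer, as [R_comul_unit] expects. *)
    + set (h := R_comul S • R_unit S). strict_lhs. reflexivity.
  - now rewrite R_comul_unit, !mcompA.
Qed.

(** The right R of λ carries η_R, so [rho_unR] turns the two-sided action into β; both β then follow
    a projection and become [betaB]. *)
Lemma F_prR X Y p :
  wm_F S X Y ▷ p = bT (tens (T X) Y) p • (tens (T X) Y ◁ mu p
    • (uT (tens (T X) Y) (B :: p)
    • (betaB (wm_mul T (tens (T X) Y)) (B :: p)
    • (B ◁ Tu2 (T X) Y (B :: p)
    • (B ◁ betaB (wm_mul T X) (Y :: B :: p)
    • (uu (T X :: Y :: B :: p)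
    • (u2 (T X) Y (B :: p) • uT (tens (T X) Y) p))))))).
Proof.
  rewrite F_layers. do 3 f_equal.
  layer (uu_i D (T X ◁ Y ◁ unR (B :: p))).
  layer (lw_eq2 B (prR_i (T X ◁ Y ◁ unR (B :: p)))).
  layer (prR_i (R ◁ T X ◁ Y ◁ unR (B :: p))).
  layer (lw_eq2 R (betaw_i (wm_mul T X) (Y ◁ unR (B :: p)))).
  layer (lw_eq2 R (Tu2_i (T X) Y (unR (B :: p)))).
  layer (rho_unR _ _).
  layer (eq_sym (prR_i (beta_rw (wm_mul T X) (Y :: B :: p)))).
  layer (eq_sym (prR_i (Tu2 (T X) Y (B :: p)))).
  layer (beta_prR _ _). layer (lw_eq2 B (beta_prR _ _)). reflexivity.
Qed.

Lemma F_galois X Y p :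
  wm_F S X Y ▷ p = bF X Y p • (X ◁ ygalois r Y p • uF X Y p).
Proof.
  rewrite F_prR, <- coreF_ygalois.
  layer (betaB_m_Tu (T X) Y (B :: p)).
  layer (eq_sym (b2_i (T X) Y (mu p))).
  unfold bF, uF. rewrite !mcompA. do 2 f_equal.
  rewrite <- (mcomp1f (T X ◁ Y ◁ mu p • _)), <- (uTK X (Y :: B :: p)), !mcompA.
  f_equal. layer (uT_i X (Y ◁ mu p)). layer (slide2_uT X Y (B :: p)).
  layer (lw_eq2 B (betaB_m X (Y :: B :: p))). layer (eq_sym (uu_i D (uT X (Y :: B :: p)))).
  unfold coreF. now rewrite !mcompA.
Qed.

Lemma wm_E_galois X Y :
  wm_E (wm_mul T X) (wm_mul T Y) = bE X Y [] • (X ◁ ygalois t Y [] • uE X Y []).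
Proof.
  refine (eq_trans (eq_sym (mtens_nil (wm_E (wm_mul T X) (wm_mul T Y)))) _).
  exact (E_galois X Y []).
Qed.

Lemma wm_can_galois X Y :
  wm_can T X Y = bE X Y [] • (X ◁ ygalois (mid B) Y [] • uF X Y []).
Proof.
  refine (eq_trans (eq_sym (mtens_nil (wm_can T X Y))) _). exact (can_galois X Y []).
Qed.

Lemma wm_F_galois X Y :
  wm_F S X Y = bF X Y [] • (X ◁ ygalois r Y [] • uF X Y []).
Proof.
  refine (eq_trans (eq_sym (mtens_nil (wm_F S X Y))) _). exact (F_galois X Y []).
Qed.

(** * From an antipode to χ *)

Definition chi f X Y : [T X; T Y] ⇒ [T (tens (T X) Y)] :=
  bF X Y [] • (X ◁ ygalois f Y [] • uE X Y []).

Lemma Tm_single X X' (f : [X] ⇒ [X']) p :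
  rw1 (Tm T f) p = bT X' p • (rw1 f (B :: p) • uT X p).
Proof.
  refine (eq_trans (Tm_layers (l := [X]) (l' := [X']) f p) _).
  refine (f_equal2 (@mcomp _ _ _ _) eq_refl _).
  refine (eq_trans (f_equal2 (@mcomp _ _ _ _) (box1 _ _) eq_refl) _).
  refine (eq_trans (mcomp1f _) (f_equal2 (@mcomp _ _ _ _) eq_refl _)).
  exact (eq_trans (f_equal2 (@mcomp _ _ _ _) (unbox1 _ _) eq_refl) (mcomp1f _)).
Qed.

Lemma Tm_pair X X' Y Y' (f : [X] ⇒ [X']) (g : [Y] ⇒ [Y']) :
  Tm T (f ⊗ g) = bT (tens X' Y') [] • (b2 X' Y' [B] • (rw1 f [Y'; B] • (X ◁ rw1 g [B]
    • (u2 X Y [B] • uT (tens X Y) [])))).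
Proof.
  refine (eq_trans (eq_sym (mtens_nil (Tm T (f ⊗ g)))) _).
  refine (eq_trans (Tm_layers (l := [X; Y]) (l' := [X'; Y']) (f ⊗ g) []) _).
  do 2 refine (f_equal2 (@mcomp _ _ _ _) eq_refl _).
  transitivity ((rw1 f [Y'; B] • X ◁ rw1 g [B]) • (u2 X Y [B] • uT (tens X Y) [])).
  - refine (f_equal2 (@mcomp _ _ _ _) _ eq_refl). strict_lhs. reflexivity.
  - now rewrite mcompA.
Qed.

Lemma chi_natural f : wm_chi_natural (T := T) (chi f).
Proof.
  intros X X' Y Y' g h.
  assert (H : Tm T g ⊗ Tm T h = rw1 (Tm T g) [T Y'] • T X ◁ rw1 (Tm T h) []).
  { refine (eq_trans (mtens_rw_lws (Tm T g) (Tm T h)) _).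
    refine (f_equal2 (@mcomp _ _ _ _) eq_refl _).
    exact (f_equal (fun z => T X ◁ z) (eq_sym (mtens_nil (Tm T h)))). }
  rewrite H. clear H.
  refine (eq_trans _ (f_equal (fun z => z • chi f X Y) (eq_sym (Tm_pair (Tm T g) h)))).
  unfold chi. rewrite !Tm_single.
  cbn [tensl].
  transitivity (bF X' Y' [] • (X' ◁ B ◁ rw1 h [B] • (X' ◁ ygalois f Y []
    • (rw1 g [B; Y; B] • uE X Y [])))).
  - unfold uE. rewrite !lw_comp, !mcompA.
    layer (uT_i X (bT Y' [])). layer (uT_i X (rw1 h [B])).
    layer (rw1_i g (B ◁ bT Y' [])). layer (rw1_i g (B ◁ rw1 h [B])).
    layer (bT_i X' (bT Y' [])). layer (lw_eq2 (T X') (bTK Y' [])).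
    rewrite lw_id, mcomp1f, bTKr.
    layer (lw_eq2 X' (eq_sym (ygalois_nat f h []))). reflexivity.
  - unfold bF. rewrite !mcompA, bTKr. layer (u2b2 (T X) Y [B]). rewrite mcomp1f.
    layer (uT_i X (rw1 h [B])). rewrite bTKr.
    layer (rw1_i g (B ◁ rw1 h [B])). layer (rw1_i g (ygalois f Y [])). reflexivity.
Qed.

(** As Φ reverses convolution, the four conditions on χ read t ∗ ν = ν, ν ∗ r = ν, id ∗ ν = r and ν
    ∗ id = t. *)
Lemma right_Hopf_of_antipode f : is_antipode f -> is_right_weak_Hopf_monad T.
Proof.
  intros (H1 & H2 & H3). exists S, (chi f). split; [apply chi_natural |].
  (* Rebracketing (ν ∗ id) ∗ ν is associativity of composition, seen through the injective Φ. *)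
  assert (H4 : convolution f r = f).
  { apply (galois_fw_inj W). intros p.
    transitivity (galois (convolution (convolution f (mid B)) f) p);
      [| now rewrite H3].
    rewrite <- H2, <- !galois_comp by exact W. apply mcompA. }
  rewrite H1 in H3. intros X Y. repeat split.
  - refine (eq_trans (f_equal (fun z => chi f X Y • z) (wm_E_galois X Y)) _).
    unfold chi. rewrite !mcompA. layer (bEK X Y []). rewrite mcomp1f.
    layer (lw_eq2 X (ygalois_comp W f t Y [])). now rewrite H3.
  - refine (eq_trans (f_equal (fun z => z • chi f X Y) (wm_F_galois X Y)) _).
    unfold chi. rewrite !mcompA. layer (bFK X Y []). rewrite mcomp1f.
    layer (lw_eq2 X (ygalois_comp W r f Y [])). now rewrite H4.
  - refine (eq_trans (f_equal (fun z => chi f X Y • z) (wm_can_galois X Y)) _).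
    refine (eq_trans _ (eq_sym (wm_F_galois X Y))).
    unfold chi. rewrite !mcompA. layer (bEK X Y []). rewrite mcomp1f.
    layer (lw_eq2 X (ygalois_comp W f (mid B) Y [])). now rewrite H2.
  - refine (eq_trans (f_equal (fun z => z • chi f X Y) (wm_can_galois X Y)) _).
    refine (eq_trans _ (eq_sym (wm_E_galois X Y))).
    unfold chi. rewrite !mcompA. layer (bFK X Y []). rewrite mcomp1f.
    layer (lw_eq2 X (ygalois_comp W (mid B) f Y [])). now rewrite H1.
Qed.

(** * From χ to an antipode *)

Definition drop_units p : K :: B :: K :: B :: p ⇒ B :: B :: p :=
  u0 (B :: B :: p) • K ◁ B ◁ u0 (B :: p).
Definition add_units p : B :: B :: p ⇒ K :: B :: K :: B :: p :=
  K ◁ B ◁ b0 (B :: p) • b0 (B :: B :: p).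

Lemma add_unitsK p : drop_units p • add_units p = lid (B :: B :: p).
Proof.
  unfold drop_units, add_units. rewrite mcompA. layer (lw_eq2 K (lw_eq2 B (u0b0 (B :: p)))).
  rewrite !lw_id, mcomp1f. apply u0b0.
Qed.

Lemma drop_unitsK p : add_units p • drop_units p = lid (K :: B :: K :: B :: p).
Proof.
  unfold drop_units, add_units. rewrite mcompA. layer (b0u0 (B :: B :: p)). rewrite mcomp1f.
  rewrite <- !lw_comp, b0u0. now rewrite !lw_id.
Qed.

(** For Y = K the conjugating crossings are trivial, by naturality of the braiding in the unit
    isomorphism. *)
Lemma galois_drop_units f p : drop_units p • K ◁ ygalois f K p = galois f p • drop_units p.
Proof.
  assert (H : B ◁ u0 p • sw K B p = u0 (B :: p)).
  { symmetry. crossing (xl_nat B (unbox []) p). }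
  assert (H' : u0 (B :: p) • swi K B p = B ◁ u0 p).
  { rewrite <- H, mcompA, swiK. apply mcompf1. }
  unfold drop_units, ygalois, galois. rewrite !lw_comp, !mcompA.
  layer (lw_eq2 K (lw_eq2 B H')).
  layer (lw_eq2 K (eq_sym (mu_i D (B ◁ u0 p)))).
  layer (lw_eq2 K (lw_eq2 B (eq_sym (fw_i (B ◁ u0 p) f)))).
  layer (lw_eq2 K (lw_eq2 B (eq_sym (de_i D (u0 p))))).
  layer (lw_eq2 K (lw_eq2 B H)).
  layer (u0_i (mu (B :: p))). layer (u0_i (B ◁ rwB f (B :: p))). layer (u0_i (B ◁ de p)).
  reflexivity.
Qed.

Lemma galois_add_units f p : K ◁ ygalois f K p • add_units p = add_units p • galois f p.
Proof.
  rewrite <- (mcompf1 (galois f p)), <- add_unitsK. layer (eq_sym (galois_drop_units f p)).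
  now rewrite <- (mcompA (add_units p)), drop_unitsK, mcomp1f.
Qed.

(** χ_(K,K) is carried to an endomorphism [h] of B ⊗ B along the identifications of its source and
    target with B ⊗ B. *)
Lemma antipode_of_right_Hopf :
  (exists chi : forall X Y, [T X; T Y] ⇒ [T (tens (T X) Y)], forall X Y,
    chi X Y • wm_E (wm_mul T X) (wm_mul T Y) = chi X Y /\
    wm_F S X Y • chi X Y = chi X Y /\
    chi X Y • wm_can T X Y = wm_F S X Y /\
    wm_can T X Y • chi X Y = wm_E (wm_mul T X) (wm_mul T Y)) ->
  exists f, is_antipode f.
Proof.
  intros [ch Hch]. destruct (Hch K K) as (H1 & H2 & H3 & H4). clear Hch.
  set (c := ch K K) in *. clearbody c. clear ch.
  set (cw p := c ▷ p : T K :: T K :: p ⇒ T (tens (T K) K) :: p).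
  set (h := drop_units [] • (uF K K [] • (c • (bE K K [] • add_units []))) : [B; B] ⇒ [B; B]).
  assert (Hh : forall p, rw2 h p = drop_units p • (uF K K p • (cw p • (bE K K p • add_units p)))).
  { intros p. unfold rw2, h. rewrite !rw_comp.
    refine (f_equal2 (@mcomp _ _ _ _) _ (f_equal2 (@mcomp _ _ _ _) _
     (f_equal2 (@mcomp _ _ _ _) eq_refl (f_equal2 (@mcomp _ _ _ _) _ _)))).
    - unfold drop_units. rewrite rw_comp, !lw_rw.
      exact (f_equal2 (@mcomp _ _ _ _) (rw_rw (unbox []) [B; B] p)
        (f_equal (fun z => K ◁ B ◁ z) (rw_rw (unbox []) [B] p))).
    - unfold uF. rewrite !rw_comp.
      exact (f_equal2 (@mcomp _ _ _ _) (rw_rw (unbox [K; B]) [K; B] p)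
        (f_equal2 (@mcomp _ _ _ _) (rw_rw (unbox [T K; K]) [B] p)
        (rw_rw (unbox [tens (T K) K; B]) [] p))).
    - unfold bE. rewrite rw_comp, lw_rw.
      exact (f_equal2 (@mcomp _ _ _ _)
        (f_equal (fun z => T K ◁ z) (rw_rw (box [K; B]) [] p))
        (rw_rw (box [K; B]) [K; B] p)).
    - unfold add_units. rewrite rw_comp, !lw_rw.
      exact (f_equal2 (@mcomp _ _ _ _)
        (f_equal (fun z => K ◁ B ◁ z) (rw_rw (box []) [B] p))
        (rw_rw (box []) [B; B] p)). }
  (* [C1] to [C4] are the four conditions on χ_(K,K) with outer rebracketings cancelled, under
     arbitrarily many strands. *)
  assert (C1 : forall p, cw p • (bE K K p • K ◁ ygalois t K p) = cw p • bE K K p).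
  { intros p. rewrite <- (mcompf1 (K ◁ _)), <- (bEK K K p).
    apply (f_equal (fun z => z ▷ p)) in H1. rewrite rw_comp in H1.
    refine (eq_trans _ (f_equal (fun z => z • bE K K p) H1)).
    refine (eq_trans _ (f_equal (fun z => cw p • z • bE K K p)
      (eq_sym (E_galois K K p)))).
    now rewrite !mcompA. }
  assert (C2 : forall p, K ◁ ygalois r K p • (uF K K p • cw p) = uF K K p • cw p).
  { intros p. rewrite <- (mcomp1f (K ◁ ygalois r K p • _)), <- (bFK K K p).
    apply (f_equal (fun z => z ▷ p)) in H2. rewrite rw_comp in H2.
    refine (eq_trans _ (f_equal (fun z => uF K K p • z) H2)).
    refine (eq_trans _ (f_equal (fun z => uF K K p • (z • cw p))
      (eq_sym (F_galois K K p)))).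
    now rewrite !mcompA. }
  assert (C3 : forall p, cw p • (bE K K p • K ◁ ygalois (mid B) K p)
    = bF K K p • K ◁ ygalois r K p).
  { intros p. rewrite <- (mcompf1 (K ◁ ygalois (mid B) K p)),
      <- (mcompf1 (K ◁ ygalois r K p)), <- (bFK K K p).
    apply (f_equal (fun z => z ▷ p)) in H3. rewrite rw_comp in H3.
    transitivity ((cw p • (wm_can T K K ▷ p)) • bF K K p).
    - refine (eq_trans _ (f_equal (fun z => cw p • z • bF K K p)
        (eq_sym (can_galois K K p)))).
      now rewrite !mcompA.
    - refine (eq_trans (f_equal (fun z => z • bF K K p)
        (eq_trans H3 (F_galois K K p))) _).
      now rewrite !mcompA. }
  assert (C4 : forall p, K ◁ ygalois (mid B) K p • (uF K K p • cw p)
    = K ◁ ygalois t K p • uE K K p).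
  { intros p. rewrite <- (mcomp1f (K ◁ ygalois (mid B) K p • _)),
      <- (mcomp1f (K ◁ ygalois t K p • _)), <- (bEK K K p).
    apply (f_equal (fun z => z ▷ p)) in H4. rewrite rw_comp in H4.
    transitivity (uE K K p • ((wm_can T K K ▷ p) • cw p)).
    - refine (eq_trans _ (f_equal (fun z => uE K K p • (z • cw p))
        (eq_sym (can_galois K K p)))).
      now rewrite !mcompA.
    - refine (eq_trans (f_equal (fun z => uE K K p • z)
        (eq_trans H4 (E_galois K K p))) _).
      now rewrite !mcompA. }
  apply (antipode_of_galois_inverse W (h := h)); intros p; rewrite !Hh, ?mcompA.
  - layer (eq_sym (galois_add_units t p)). layer (C1 p). reflexivity.
  - layer (eq_sym (galois_drop_units r p)). layer (C2 p). reflexivity.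
  - layer (eq_sym (galois_add_units (mid B) p)). layer (C3 p). layer (bFK K K p).
    rewrite mcomp1f. layer (galois_drop_units r p). now rewrite add_unitsK, mcompf1.
  - layer (eq_sym (galois_drop_units (mid B) p)). layer (C4 p). layer (bEK K K p).
    rewrite mcomp1f. layer (galois_drop_units t p). now rewrite add_unitsK, mcompf1.
Qed.

End Base.

Lemma right_weak_Hopf_iff (HC : cauchy_complete M) :
  is_right_weak_Hopf_monad T <-> is_weak_Hopf_monoid D.
Proof.
  split.
  - intros (S & ch & _ & H). split; [exact W |].
    apply (antipode_of_right_Hopf (S := S)). now exists ch.
  - intros [_ [f Hf]].
    destruct (HC (T K) (wm_sqcap T)) as [S].
    (* The idempotent to be split is t up to TK ≅ B, so [t_idem] applies. *)
    + pose proof (rw_comp (wm_sqcap T : [T K] ⇒ [T K]) (wm_sqcap T : [T K] ⇒ [T K]) []) as H.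
      assert (E : rw1 (wm_sqcap T) [] • rw1 (wm_sqcap T) [] = rw1 (wm_sqcap T) []).
      { rewrite sqcap_layers, !mcompA. layer (kTK []). rewrite mcomp1f.
        layer (t_idem W []). reflexivity. }
      refine (eq_trans (eq_sym (mtens_nil (_ : [T K] ⇒ [T K]))) _).
      refine (eq_trans (eq_trans H E) _). exact (mtens_nil (wm_sqcap T)).
    + exact (right_Hopf_of_antipode S Hf).
Qed.
End TensorMonad.

(** * Reversal *)

(** Both conditions mention only structure maps, which double reversal restores; the case analysis
    lets the projections compute. *)
Lemma right_weak_Hopf_rev_rev (M : monoidal) (T : weak_bimonad_data M) :
  is_right_weak_Hopf_monad (rev_weak_bimonad (rev_weak_bimonad T))
  <-> is_right_weak_Hopf_monad T.
Proof.
  destruct M, T. reflexivity.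
Qed.

(** * Mirror images of diagrams *)

Section Flip.
Variable M : monoidal.
Implicit Types l m : list M.

Definition rtensl l : M := tensl (M := rev_monoidal M) l.
Definition rjoinl l m : hom (tens (rtensl m) (rtensl l)) (rtensl (l ++ m)) :=
  joinl (M := rev_monoidal M) l m.
Definition rsplitl l m : hom (rtensl (l ++ m)) (tens (rtensl m) (rtensl l)) :=
  splitl (M := rev_monoidal M) l m.

Lemma rsplitlK l m : rjoinl l m ∘ rsplitl l m = idm (rtensl (l ++ m)).
Proof. exact (splitlK (M := rev_monoidal M) l m). Qed.

(** In the reversed category [l] denotes the left-nested product of [rev l] in M; this map
    rebrackets it to the right. *)
Fixpoint flip l : hom (rtensl l) ⟦rev l⟧ :=
  match l return hom (rtensl l) ⟦rev l⟧ with
  | [] => idm munit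
  | X :: l' =>
    match l' return hom (rtensl l') ⟦rev l'⟧ ->
      hom (rtensl (X :: l')) ⟦rev (X :: l')⟧
    with
    | [] => fun _ => idm X
    | Y :: l'' => fun rec => joinl (rev (Y :: l'')) [X] ∘ tensh rec (idm X)
    end (flip l')
  end.

Fixpoint flipi l : hom ⟦rev l⟧ (rtensl l) :=
  match l return hom ⟦rev l⟧ (rtensl l) with
  | [] => idm munit
  | X :: l' =>
    match l' return hom ⟦rev l'⟧ (rtensl l') ->
      hom ⟦rev (X :: l')⟧ (rtensl (X :: l'))
    with
    | [] => fun _ => idm X
    | Y :: l'' => fun rec => tensh rec (idm X) ∘ splitl (rev (Y :: l'')) [X]
    end (flipi l')
  end.

Lemma flipK l : flipi l ∘ flip l = idm _.
Proof.
  induction l as [|X [|Y l] IH]; [apply comp_idl | apply comp_idl |].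
  set (k := Y :: l) in *.
  change (tensh (flipi k) (idm X) ∘ splitl (rev k) [X]
    ∘ (joinl (rev k) [X] ∘ tensh (flip k) (idm X)) = idm (tens (rtensl k) X)).
  rewrite compA, <- (compA (tensh _ _)), joinlK, comp_idr.
  apply (tensh_inv IH (comp_idl _)).
Qed.

Lemma flipiK l : flip l ∘ flipi l = idm _.
Proof.
  induction l as [|X [|Y l] IH]; [apply comp_idl | apply comp_idl |].
  set (k := Y :: l) in *.
  change (joinl (rev k) [X] ∘ tensh (flip k) (idm X)
    ∘ (tensh (flipi k) (idm X) ∘ splitl (rev k) [X]) = idm ⟦rev k ++ [X]⟧).
  rewrite compA, <- (compA (joinl _ _)). cbn [tensl].
  rewrite (tensh_inv (IH : flip k ∘ flipi k = _) (comp_idl (idm X))), comp_idr.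
  apply splitlK.
Qed.

Lemma flip_cons X l :
  flip (X :: l) ∘ rjoinl [X] l = joinl (rev l) [X] ∘ tensh (flip l) (idm X).
Proof.
  destruct l as [|Y l].
  - cbn. now rewrite tensh_id, comp_idl, comp_idr.
  - apply comp_idr.
Qed.

Fixpoint rev_appT l m : rev (l ++ m) = rev m ++ rev l :=
  match l with
  | [] => eq_sym (app0 (rev m))
  | X :: l' => eq_trans (f_equal (fun z => z ++ [X]) (rev_appT l' m))
      (appA (rev m) (rev l') [X])
  end.

Lemma castl_trans (a b c : list M) (e : a = b) (e' : b = c) :
  castl (eq_trans e e') = castl e' ∘ castl e.
Proof. destruct e', e. symmetry. apply comp_idl. Qed.

Lemma castl_sym (a b : list M) (e : a = b) : castl (eq_sym e) ∘ castl e = idm _.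
Proof. destruct e. apply comp_idl. Qed.

Lemma castl_app (a b : list M) X (e : a = b) :
  castl (f_equal (fun z => z ++ [X]) e) ∘ joinl a [X]
  = joinl b [X] ∘ tensh (castl e) (idm X).
Proof. destruct e. cbn [castl f_equal]. now rewrite tensh_id, comp_idl, comp_idr. Qed.

(** The induction step plays [joinA] in the reversed category against [joinA] in M. *)
Lemma flip_join l m :
  castl (rev_appT l m) ∘ flip (l ++ m) ∘ rjoinl l m
  = joinl (rev m) (rev l) ∘ tensh (flip m) (flip l).
Proof.
  induction l as [|X l IH].
  - change (castl (eq_sym (app0 (rev m))) ∘ flip m ∘ runit (rtensl m)
      = joinl (rev m) [] ∘ tensh (flip m) (idm munit)).
    rewrite <- compA. rewrite <- (runit_nat (flip m)), <- (join0 (rev m)).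
    rewrite !compA, castl_sym, comp_idl. reflexivity.
  - assert (Hi : tensh (idm (rtensl m)) (rjoinl [X] l)
        ∘ tensh (idm (rtensl m)) (rsplitl [X] l) = idm _).
    { apply (tensh_inv (comp_idl _) (rsplitlK [X] l)). }
    apply (epi_cancel Hi).
    assert (HA : rjoinl (X :: l) m ∘ tensh (idm (rtensl m)) (rjoinl [X] l)
      = rjoinl [X] (l ++ m) ∘ tensh (rjoinl l m) (idm X)
        ∘ associ (rtensl m) (rtensl l) X).
    { refine (eq_trans _ (joinA (M := rev_monoidal M) [X] l m)).
      exact (f_equal (fun z => z ∘ tensh (idm (rtensl m)) (rjoinl [X] l))
        (eq_sym (comp_idl (rjoinl (X :: l) m)))). }
    change (castl (eq_trans (f_equal (fun z => z ++ [X]) (rev_appT l m))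
        (appA (rev m) (rev l) [X])) ∘ flip (X :: (l ++ m)) ∘ rjoinl (X :: l) m
      ∘ tensh (idm (rtensl m)) (rjoinl [X] l)
      = joinl (rev m) (rev l ++ [X]) ∘ tensh (flip m) (flip (X :: l))
      ∘ tensh (idm (rtensl m)) (rjoinl [X] l)).
    rewrite castl_trans, <- compA. cbn [app] in HA |- *. rewrite HA, !compA.
    rewrite <- (compA _ (flip (X :: l ++ m)) (rjoinl [X] (l ++ m))), flip_cons.
    rewrite <- (compA (joinl _ _)), <- tensh_comp, comp_idr, flip_cons.
    rewrite !compA, <- (compA _ (castl _) (joinl _ _)).
    rewrite (castl_app X (rev_appT l m)), !compA.
    rewrite <- (compA _ (tensh (castl _) _)), <- tensh_compr.
    rewrite <- (compA _ (tensh _ (idm X)) (tensh (rjoinl l m) _)), <- tensh_compr, IH.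
    rewrite tensh_compr, !compA.
    pose proof (joinA (rev m) (rev l) [X]) as HJ. cbn [tensl] in HJ |- *.
    rewrite HJ. clear HJ.
    rewrite <- (compA _ _ (tensh (tensh _ _) _)), assoc_nat, !compA.
    rewrite <- (compA _ (assoc _ _ _)), associK, comp_idr.
    rewrite <- compA, <- tensh_comp, comp_idl. reflexivity.
Qed.

(** Conjugation by isomorphisms, hence faithful: an equation in the reversed category may be checked
    on its mirror image in M. *)
Definition mflip l m (f : mhom (M := rev_monoidal M) l m) : rev l ⇒ rev m :=
  flip m ∘ (f : hom (rtensl l) (rtensl m)) ∘ flipi l.

Lemma mflip_inj l m (f g : mhom (M := rev_monoidal M) l m) :
  mflip f = mflip g -> f = g.
Proof. apply (comp_inj (flipK m) (flipK l)). Qed.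

Lemma mflip_comp l m n (g : mhom (M := rev_monoidal M) m n)
    (f : mhom (M := rev_monoidal M) l m) :
  mflip (mcomp (M := rev_monoidal M) g f) = mflip g • mflip f.
Proof.
  unfold mflip, mcomp. cbn [mcat rev_monoidal].
  rewrite !compA, <- (compA _ (flipi m)), flipK, comp_idr. reflexivity.
Qed.

Lemma mflip_mtens l l' m m' (f : mhom (M := rev_monoidal M) l l')
    (g : mhom (M := rev_monoidal M) m m') :
  eq_rect _ (fun a => a ⇒ rev m' ++ rev l')
    (eq_rect _ (fun b => rev (l ++ m) ⇒ b) (mflip (mtens (M := rev_monoidal M) f g))
      _ (rev_appT l' m')) _ (rev_appT l m) = mflip g ⊗ mflip f.
Proof.
  apply castl_rect.
  set (f' := f : hom (rtensl l) (rtensl l')).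
  set (g' := g : hom (rtensl m) (rtensl m')).
  change (castl (rev_appT l' m') ∘ (flip (l' ++ m') ∘ (rjoinl l' m' ∘ tensh g' f'
    ∘ rsplitl l m) ∘ flipi (l ++ m))
    = joinl (rev m') (rev l')
      ∘ tensh (flip m' ∘ g' ∘ flipi m) (flip l' ∘ f' ∘ flipi l)
      ∘ splitl (rev m) (rev l) ∘ castl (rev_appT l m)).
  rewrite !compA, flip_join.
  assert (H : rsplitl l m ∘ flipi (l ++ m)
    = tensh (flipi m) (flipi l) ∘ splitl (rev m) (rev l) ∘ castl (rev_appT l m)).
  { assert (Hq : tensh (flipi m) (flipi l) ∘ splitl (rev m) (rev l)
      ∘ (joinl (rev m) (rev l) ∘ tensh (flip m) (flip l)) = idm _).
    { rewrite compA, <- (compA (tensh _ _)), joinlK, comp_idr.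
      apply (tensh_inv (flipK m) (flipK l)). }
    apply (mono_cancel Hq).
    rewrite <- flip_join at 1.
    rewrite !compA, <- (compA _ (rjoinl l m)), rsplitlK, comp_idr.
    rewrite <- (compA _ (flip (l ++ m))), flipiK, comp_idr.
    rewrite <- (compA (joinl _ _)), (tensh_inv (flipiK m) (flipiK l)), comp_idr.
    now rewrite splitlK, comp_idl. }
  rewrite <- (compA _ (rsplitl l m)), H, !compA. do 2 f_equal.
  rewrite <- !compA, <- !tensh_comp, !compA. reflexivity.
Qed.
End Flip.

(** * Mirror images of the generators *)

Section FlipCompatibility.
Variable M : monoidal.
Local Notation Mr := (rev_monoidal M).

Lemma mflip_comp_eq (l m n : list M) (g : mhom (M := Mr) m n) (f : mhom (M := Mr) l m)
    (g' : rev m ⇒ rev n) (f' : rev l ⇒ rev m) :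
  mflip g = g' -> mflip f = f' -> mflip (mcomp (M := Mr) g f) = g' • f'.
Proof. intros <- <-. apply mflip_comp. Qed.

Lemma mflip_mtens_eq (l l' m m' : list M) (f : mhom (M := Mr) l l')
    (g : mhom (M := Mr) m m') (f' : rev l ⇒ rev l') (g' : rev m ⇒ rev m') :
  mflip f = f' -> mflip g = g' ->
  eq_rect _ (fun a => a ⇒ rev m' ++ rev l')
    (eq_rect _ (fun b => rev (l ++ m) ⇒ b) (mflip (mtens (M := Mr) f g))
      _ (rev_appT l' m')) _ (rev_appT l m) = g' ⊗ f'.
Proof. intros <- <-. apply mflip_mtens. Qed.

(** With at most two strands there is nothing to rebracket, which is why each generator is its own
    mirror image. *)
Lemma flip_pair (X Y : M) : flip [X; Y] = idm (tens Y X).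
Proof. cbn. rewrite tensh_id. apply comp_idl. Qed.

Lemma flipi_pair (X Y : M) : flipi [X; Y] = idm (tens Y X).
Proof. cbn. rewrite tensh_id. apply comp_idl. Qed.

Lemma mflip_mid (X : M) : mflip (mid (M := Mr) X) = mid X.
Proof. exact (eq_trans (comp_idr _) (comp_idl (idm X))). Qed.

Lemma mflip11 (X Y : M) (f : [X] ⇒ [Y]) : mflip (M := M) (l := [X]) (m := [Y]) f = f.
Proof. exact (eq_trans (comp_idr _) (comp_idl f)). Qed.

Lemma mflip01 (X : M) (f : [] ⇒ [X]) : mflip (M := M) (l := []) (m := [X]) f = f.
Proof. exact (eq_trans (comp_idr _) (comp_idl f)). Qed.

Lemma mflip10 (X : M) (f : [X] ⇒ []) : mflip (M := M) (l := [X]) (m := []) f = f.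
Proof. exact (eq_trans (comp_idr _) (comp_idl f)). Qed.

Lemma mflip21 (X Y Z : M) (f : [X; Y] ⇒ [Z]) :
  mflip (M := M) (l := [Y; X]) (m := [Z]) f = f.
Proof.
  refine (eq_trans (f_equal (fun z => idm Z ∘ f ∘ z) (flipi_pair Y X)) _).
  exact (eq_trans (comp_idr _) (comp_idl f)).
Qed.

Lemma mflip12 (X Y Z : M) (f : [Z] ⇒ [X; Y]) :
  mflip (M := M) (l := [Z]) (m := [Y; X]) f = f.
Proof.
  refine (eq_trans (f_equal (fun z => z ∘ f ∘ idm Z) (flip_pair Y X)) _).
  exact (eq_trans (comp_idr _) (comp_idl f)).
Qed.

Lemma mflip22 (X Y Z U : M) (f : [X; Y] ⇒ [Z; U]) :
  mflip (M := M) (l := [Y; X]) (m := [U; Z]) f = f.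
Proof.
  refine (eq_trans (f_equal (fun z => z ∘ f ∘ flipi [Y; X]) (flip_pair U Z)) _).
  refine (eq_trans (f_equal (fun z => idm (tens Z U) ∘ f ∘ z) (flipi_pair Y X)) _).
  exact (eq_trans (comp_idr _) (comp_idl f)).
Qed.
End FlipCompatibility.

(** Computes the mirror image of a diagram together with the proof, by recursion on the term; the
    ascription in the tensor case discards transports along [rev_appT] by conversion. *)
Ltac flip_proof M e :=
  lazymatch e with
  | mcomp ?g ?f =>
    let pg := flip_proof M g in let pf := flip_proof M f in
    constr:(mflip_comp_eq (M := M) pg pf)
  | mtens ?f ?g =>
    let pf := flip_proof M f in let pg := flip_proof M g in
    lazymatch type of pf with _ = ?f' =>
    lazymatch type of pg with _ = ?g' =>
      constr:(mflip_mtens_eq (M := M) pf pg : mflip (M := M) e = g' ⊗ f')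
    end end
  | mid ?X => constr:(mflip_mid (M := M) X)
  | bm_mul ?D => constr:(mflip21 (M := M) (bm_mul D))
  | bm_comul ?D => constr:(mflip12 (M := M) (bm_comul D))
  | bm_unit ?D => constr:(mflip01 (M := M) (bm_unit D))
  | bm_counit ?D => constr:(mflip10 (M := M) (bm_counit D))
  | mbr ?X ?Y => constr:(mflip22 (M := M) (mbr Y X))
  | mbri ?X ?Y => constr:(mflip22 (M := M) (mbri Y X))
  end.

Ltac flip_goal M H :=
  apply (mflip_inj (M := M));
  match goal with |- mflip ?a = mflip ?b =>
    let pa := flip_proof M a in let pb := flip_proof M b in
    exact (eq_trans pa (eq_trans H (eq_sym pb)))
  end.

Section ReverseBimonoid.
Variables (M : braided) (D : bimonoid_data M).
Hypothesis W : is_weak_bimonoid D.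
Local Notation B := (bm_obj D).

(** Mirroring turns μ (μ ⊗ B) into μ (B ⊗ μ), so (v) is needed with the other bracketing. *)
Lemma epsilon_assoc : bm_counit D • bm_mul D • (mid B ⊗ bm_mul D)
  = bm_counit D • bm_mul D • (bm_mul D ⊗ mid B).
Proof.
  refine (eq_trans (mcompA _ _ _) (eq_trans _ (eq_sym (mcompA _ _ _)))).
  exact (f_equal (fun z => bm_counit D • z) (eq_sym (wb_mulA W))).
Qed.

Lemma eta_coassoc : (mid B ⊗ bm_comul D) • bm_comul D • bm_unit D
  = (bm_comul D ⊗ mid B) • bm_comul D • bm_unit D.
Proof. exact (f_equal (fun z => z • bm_unit D) (eq_sym (wb_comulA W))). Qed.

Lemma rev_is_weak_bimonoid : is_weak_bimonoid (M := rev_braided M) (rev_bimonoid D).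
Proof.
  split; cbn [bm_obj bm_mul bm_unit bm_comul bm_counit rev_bimonoid bmon rev_braided].
  - flip_goal M (eq_sym (wb_mulA W)).
  - flip_goal M (wb_mul1r W).
  - flip_goal M (wb_mul1l W).
  - flip_goal M (eq_sym (wb_comulA W)).
  - flip_goal M (wb_comul1r W).
  - flip_goal M (wb_comul1l W).
  (* The mirror image of (f ⊗ g) ⊗ h is h ⊗ (g ⊗ f), so triple tensor products are reassociated by
     [mtensA]. *)
  - flip_goal M (eq_trans (wb_b W) (f_equal (fun z : [B; B; B; B] ⇒ [B; B; B; B] =>
      (bm_mul D ⊗ bm_mul D) • z • (bm_comul D ⊗ bm_comul D))
      (mtensA (mid B) (mbr B B) (mid B)))).
  - flip_goal M (eq_trans (eq_trans epsilon_assoc (wb_v1 W))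
      (f_equal (fun z : [B; B; B] ⇒ [B; B; B; B] =>
        (bm_counit D ⊗ bm_counit D) • (bm_mul D ⊗ bm_mul D) • z)
      (mtensA (mid B) (bm_comul D) (mid B)))).
  - flip_goal M (eq_trans (eq_trans epsilon_assoc (wb_v2 W))
      (f_equal (fun z : [B; B; B] ⇒ [B; B; B; B] =>
        (bm_counit D ⊗ bm_counit D) • (bm_mul D ⊗ bm_mul D) • z)
      (mtensA (mid B) (mbri B B • bm_comul D) (mid B)))).
  - flip_goal M (eq_trans (eq_trans eta_coassoc (wb_w1 W))
      (f_equal (fun z : [B; B; B; B] ⇒ [B; B; B] =>
        z • (bm_comul D ⊗ bm_comul D) • (bm_unit D ⊗ bm_unit D))
      (mtensA (mid B) (bm_mul D) (mid B)))).
  - flip_goal M (eq_trans (eq_trans eta_coassoc (wb_w2 W))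
      (f_equal (fun z : [B; B; B; B] ⇒ [B; B; B] =>
        z • (bm_comul D ⊗ bm_comul D) • (bm_unit D ⊗ bm_unit D))
      (mtensA (mid B) (bm_mul D • mbri B B) (mid B)))).
Qed.

Lemma rev_t : wb_t (M := rev_braided M) (rev_bimonoid D) = wb_r D.
Proof.
  refine (eq_trans (eq_sym (mflip11 (M := M) (X := B) (Y := B) _)) _).
  unfold wb_t, wb_r.
  cbn [bm_obj bm_mul bm_unit bm_comul bm_counit rev_bimonoid bmon rev_braided].
  match goal with |- mflip ?a = ?b => let pa := flip_proof M a in exact pa end.
Qed.

Lemma rev_r : wb_r (M := rev_braided M) (rev_bimonoid D) = wb_t D.
Proof.
  refine (eq_trans (eq_sym (mflip11 (M := M) (X := B) (Y := B) _)) _).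
  unfold wb_t, wb_r.
  cbn [bm_obj bm_mul bm_unit bm_comul bm_counit rev_bimonoid bmon rev_braided].
  match goal with |- mflip ?a = ?b => let pa := flip_proof M a in exact pa end.
Qed.

Lemma rev_convolution (f g : [B] ⇒ [B]) :
  convolution (M := rev_braided M) (D := rev_bimonoid D) f g = convolution (D := D) g f.
Proof.
  refine (eq_trans (eq_sym (mflip11 (M := M) (X := B) (Y := B) _)) _).
  unfold convolution.
  cbn [bm_obj bm_mul bm_unit bm_comul bm_counit rev_bimonoid bmon rev_braided].
  pose proof (mflip_mtens_eq (M := M) (l := [B]) (l' := [B]) (m := [B]) (m' := [B])
    (mflip11 (M := M) (X := B) (Y := B) f) (mflip11 (M := M) (X := B) (Y := B) g)
    : mflip (M := M) (l := [B; B]) (m := [B; B]) (mtens (M := rev_monoidal M)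
        (l1 := [B]) (l1' := [B]) (l2 := [B]) (l2' := [B]) f g) = g ⊗ f) as H.
  exact (mflip_comp_eq (mflip_comp_eq (mflip21 (bm_mul D)) H) (mflip12 (bm_comul D))).
Qed.

Lemma convolution_assoc (f g h : [B] ⇒ [B]) :
  convolution (D := D) (convolution (D := D) f g) h
  = convolution (D := D) f (convolution (D := D) g h).
Proof.
  apply (galois_fw_inj W). intros p. rewrite <- !(galois_comp W). symmetry. apply mcompA.
Qed.

(** Reversal exchanges the first two equations and turns the third into ν ∗ (id ∗ ν) = ν, which
    associativity of convolution identifies with the original. *)
Lemma rev_is_antipode (f : [B] ⇒ [B]) :
  is_antipode (M := rev_braided M) (D := rev_bimonoid D) f <-> is_antipode (D := D) f.
Proof.
  unfold is_antipode. rewrite !rev_convolution, rev_t, rev_r, convolution_assoc.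
  change (mid (M := rev_braided M) (bm_obj (rev_bimonoid D))) with (mid B).
  tauto.
Qed.
End ReverseBimonoid.

Unset Implicit Arguments.

Theorem proposition4p7 :
  forall (M : braided) (B : bimonoid_data M),
    cauchy_complete M -> is_weak_bimonoid B ->
    (is_right_weak_Hopf_monad (tensor_weak_bimonad B)
     <-> is_left_weak_Hopf_monad (rev_weak_bimonad (tensor_weak_bimonad B))) /\
    (is_left_weak_Hopf_monad (rev_weak_bimonad (tensor_weak_bimonad B))
     <-> is_weak_Hopf_monoid B) /\
    (is_weak_Hopf_monoid B
     <-> is_weak_Hopf_monoid (M := rev_braided M) (rev_bimonoid B)).
Proof.
  intros M B HC W.
  pose proof (right_weak_Hopf_rev_rev (tensor_weak_bimonad B)) as H12.
  pose proof (right_weak_Hopf_iff W HC) as H13.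
  unfold is_left_weak_Hopf_monad. rewrite H12. split; [reflexivity |].
  split; [exact H13 |]. split.
  - intros [_ [f Hf]]. split; [now apply rev_is_weak_bimonoid |].
    exists f. now apply rev_is_antipode.
  - intros [_ [f Hf]]. split; [exact W |].
    exists f. now apply rev_is_antipode.
Qed.
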